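(* If $\mathcal{P}$ is a tight chiral $4$-polytope, then its facets are chiral or its vertex-figures are chiral (or both). If $\mathcal{P}$ is a tight chiral $5$-polytope, then its facets, its vertex-figures, and its medial sections are all chiral.
   Context: An (abstract) $n$-polytope is a partially ordered set with a unique minimal face $F_{-1}$ and a unique maximal face $F_n$, all of whose maximal chains (flags) have the same length, graded by a rank function with $\operatorname{rank}F_{-1}=-1$, $\operatorname{rank}F_n=n$, satisfying the diamond condition (if $F<G$ with rank difference $2$, exactly two faces lie strictly between them) and strong connectivity (if $F<G$ with rank difference at least $3$, any two faces strictly between $F$ and $G$ are joined by a chain $H_0\le H_1\ge H_2\le\cdots$ of faces strictly between $F$ and $G$). Faces of rank $0$ are vertices, of rank $n-1$ facets. For $F\le G$ the section $G/F=\{H:F\le H\le G\}$. Facets are identified with the sections $F/F_{-1}$, vertex-figures are the sections $F_n/v$ for vertices $v$, and medial sections are the sections $F/v$ for a facet $F$ and vertex $v\le F$. Flags differing in one face are adjacent. A polytope is regular if its automorphism group acts transitively on flags, and chiral if the flags form exactly two orbits with adjacent flags in different orbits. A polytope is equivelar of type $\{p_1,\dots,p_{n-1}\}$ if for each $i$, every section $G/F$ with $F$ an $(i-2)$-face and $G$ an $(i+1)$-face is (the face lattice of) a $p_i$-gon; it is tight if it is equivelar of some type $\{p_1,\dots,p_{n-1}\}$ and has exactly $2p_1\cdots p_{n-1}$ flags. *)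

(* Defs.v *)
From HB Require Import structures.
From mathcomp Require Import all_boot all_order all_algebra.
From mathcomp Require Import classical_sets functions cardinality.

Set Implicit Arguments.
Unset Strict Implicit.
Unset Printing Implicit Defensive.

Import Order.TTheory GRing.Theory.

Local Open Scope classical_set_scope.
Local Open Scope card_scope.
Local Open Scope order_scope.

(* The section G/F as an ordered type. The proof of F <= G is a parameter of
   the type, so that F and G are its least and greatest elements. *)
Record section (d : Order.disp_t) (T : porderType d) (F G : T) (leFG : F <= G) :=
  Section { face : T; _ : F <= face <= G }.

HB.instance Definition _ d (T : porderType d) (F G : T) (leFG : F <= G) :=
  [isSub for @face d T F G leFG].
HB.instance Definition _ d (T : porderType d) (F G : T) (leFG : F <= G) :=
  [Choice of section leFG by <:].
HB.instance Definition _ d (T : porderType d) (F G : T) (leFG : F <= G) :=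
  [SubChoice_isSubPOrder of section leFG by <: with d].

Section SectionBounds.
Variables (d : Order.disp_t) (T : porderType d) (F G : T) (leFG : F <= G).

Let bot_subproof : F <= F <= G. Proof. by rewrite lexx leFG. Qed.
Let top_subproof : F <= G <= G. Proof. by rewrite leFG lexx. Qed.

Definition section_bot : section leFG := Section leFG bot_subproof.
Definition section_top : section leFG := Section leFG top_subproof.

Let section_le0x (H : section leFG) : section_bot <= H.
Proof. by rewrite -Order.le_val; case: H => H /= /andP[]. Qed.
Let section_lex1 (H : section leFG) : H <= section_top.
Proof. by rewrite -Order.le_val; case: H => H /= /andP[]. Qed.

HB.instance Definition _ :=
  Order.hasBottom.Build d (section leFG) section_le0x.
HB.instance Definition _ :=
  Order.hasTop.Build d (section leFG) section_lex1.
End SectionBounds.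

Definition section_rank (d : Order.disp_t) (T : porderType d) (rk : T -> int)
    (F G : T) (leFG : F <= G) (H : section leFG) : int :=
  (rk (val H) - rk F - 1)%R.

Definition chain (d : Order.disp_t) (T : porderType d) (C : set T) : Prop :=
  total_on C (fun x y => x <= y).

Definition flag (d : Order.disp_t) (T : porderType d) : set (set T) :=
  [set C | chain C /\ forall D : set T, chain D -> C `<=` D -> D = C].

Definition between (d : Order.disp_t) (T : porderType d) (F G : T) : set T :=
  [set H | F < H < G].

Record polytope (n : nat) (d : Order.disp_t) (T : tbPOrderType d)
    (rk : T -> int) : Prop := Polytope {
  polytope_rank_bot : rk \bot = (-1)%R;
  polytope_rank_top : rk \top = n%:Z%R;
  polytope_rank_lt : forall F G : T, F < G -> (rk F < rk G)%R;
  polytope_rank_cover : forall F G : T, F < G -> between F G = set0 ->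
    rk G = (rk F + 1)%R;
  polytope_flag_size : forall C : set T, flag C -> C #= `I_n.+2;
  polytope_diamond : forall F G : T, F < G -> rk G = (rk F + 2)%R ->
    between F G #= `I_2;
  polytope_strongly_connected : forall F G : T,
    F < G -> (rk F + 3 <= rk G)%R ->
    forall H K : T, between F G H -> between F G K ->
    exists (m : nat) (h : nat -> T),
      [/\ h 0%N = H, h m = K,
          forall i, (i <= m)%N -> between F G (h i)
        & forall i, (i < m)%N ->
            if odd i then h i.+1 <= h i else h i <= h i.+1]
}.

Definition adjacent (d : Order.disp_t) (T : porderType d) (C D : set T) : Prop :=
  exists x y : T, (C `\` D)%classic = [set x] /\ (D `\` C)%classic = [set y].

Definition automorphism (d : Order.disp_t) (T : porderType d) (f : T -> T) :
    Prop :=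
  bijective f /\ {mono f : x y / x <= y}.

Definition same_orbit (d : Order.disp_t) (T : porderType d) (C D : set T) :
    Prop :=
  exists2 f : T -> T, automorphism f & f @` C = D.

Definition two_flag_orbits (d : Order.disp_t) (T : porderType d) : Prop :=
  exists C D : set T, [/\ flag C, flag D, ~ same_orbit C D
    & forall E, flag E -> same_orbit C E \/ same_orbit D E].

Definition chiral_polytope (n : nat) (d : Order.disp_t) (T : tbPOrderType d)
    (rk : T -> int) : Prop :=
  [/\ polytope n rk, two_flag_orbits T
    & forall C D : set T, flag C -> flag D -> adjacent C D -> ~ same_orbit C D].

Inductive polygon_face (p : nat) : Type :=
  | PolygonBot
  | PolygonVertex of 'I_p
  | PolygonEdge of 'I_p
  | PolygonTop.

(* Edge j joins the vertices j and j + 1 mod p; for p = 2 this is the digon. *)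
Definition polygon_le (p : nat) (x y : polygon_face p) : bool :=
  match x, y with
  | PolygonBot, _ | _, PolygonTop => true
  | PolygonVertex i, PolygonVertex j => i == j
  | PolygonEdge i, PolygonEdge j => i == j
  | PolygonVertex i, PolygonEdge j => (i == j) || (i == ordS j)
  | _, _ => false
  end.

Definition is_polygon (p : nat) (d : Order.disp_t) (T : porderType d) : Prop :=
  (1 < p)%N /\ exists f : polygon_face p -> T,
    bijective f /\ forall x y, (f x <= f y) = polygon_le x y.

(* The type {p_1, ..., p_(n-1)} is indexed from 0, so that the number p i is
   the entry p_(i+1) of the type and concerns an (i-1)-face and an (i+2)-face. *)
Definition equivelar (n : nat) (d : Order.disp_t) (T : porderType d)
    (rk : T -> int) (p : 'I_n.-1 -> nat) : Prop :=
  forall (i : 'I_n.-1) (F G : T) (leFG : F <= G),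
    rk F = ((i : nat)%:Z - 1)%R -> rk G = ((i : nat)%:Z + 2)%R ->
    is_polygon (p i) (section leFG).

Definition tight (n : nat) (d : Order.disp_t) (T : porderType d)
    (rk : T -> int) : Prop :=
  exists p : 'I_n.-1 -> nat,
    equivelar rk p /\ flag (T:=T) #= `I_(2 * \prod_(i < n.-1) p i).

Definition chiral_facets (n : nat) (d : Order.disp_t) (T : tbPOrderType d)
    (rk : T -> int) : Prop :=
  forall F : T, rk F = (n%:Z - 1)%R ->
    chiral_polytope n.-1 (@section_rank d T rk \bot F (le0x F)).

Definition chiral_vertex_figures (n : nat) (d : Order.disp_t)
    (T : tbPOrderType d) (rk : T -> int) : Prop :=
  forall v : T, rk v = 0%R ->
    chiral_polytope n.-1 (@section_rank d T rk v \top (lex1 v)).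

Definition chiral_medial_sections (n : nat) (d : Order.disp_t)
    (T : tbPOrderType d) (rk : T -> int) : Prop :=
  forall (v F : T) (levF : v <= F), rk v = 0%R -> rk F = (n%:Z - 1)%R ->
    chiral_polytope n.-2 (@section_rank d T rk v F levF).

(* Main.v *)
(* Let the flags of a chiral polytope be acted upon by words in the flip
   operators (the monodromy action). A section type [(a, b)] of faces is regular
   exactly when a word in the letters strictly between [a] and [b] that fixes
   one flag fixes all of them. If the facets and the vertex-figures are regular,
   then any relation between facet words, or between vertex-figure words, holds
   at every flag as soon as it holds at one flag. When in addition the
   vertex-figures are flat, every word acts, uniformly on all flags, as a facet
   word followed by a vertex-figure word, and the stabilizers of all flags agree,
   so that the polytope itself would be regular.

   Tightness yields flatness: an equivelar polytope of type {p_1, ..., p_(n-1)}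
   has at least 2 p_1 ... p_(n-1) flags, and any two non-incident faces whose
   ranks differ by at least 2 produce an additional flag. In rank 5 the sections
   of corank 2 are regular, because their words commute with a flip, and the
   argument applied to the polytope and then to its facets or vertex-figures
   shows that the medial sections are not regular. *)
Require Import Defs.
From mathcomp Require Import all_boot all_order all_algebra.
From mathcomp Require Import boolp classical_sets functions cardinality.
From mathcomp Require Import zify.

Set Implicit Arguments.
Unset Strict Implicit.
Unset Printing Implicit Defensive.

Import Order.TTheory Order.SubPreorderTheory.

Local Open Scope classical_set_scope.
Local Open Scope card_scope.
Local Open Scope order_scope.

(** * Graded posets and flags encoded as sequences *)

Record graded (n : nat) (d : Order.disp_t) (T : tbPOrderType d)
    (h : T -> nat) : Prop := Graded {
  graded_bot : h \bot = 0%N;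
  graded_top : h \top = n.+1;
  graded_lt : forall x y : T, x < y -> (h x < h y)%N;
  graded_cover : forall x y : T, x < y -> between x y = set0 -> h y = (h x).+1
}.

(** Heights are ranks plus one. The heights [a] and [b] bound a section, and the indices inside are
    those of its proper faces. *)
Definition inside (a b i : nat) : bool := (a < i < b)%N.

Definition agree (T : Type) (a b : nat) (X Y : nat -> T) : Prop :=
  forall i, ~~ inside a b i -> X i = Y i.

Definition orbit_eq (d : Order.disp_t) (T : porderType d) (X Y : nat -> T) :
    Prop :=
  exists2 f : T -> T, automorphism f & f \o X = Y.

Section Graded.
Variables (n : nat) (d : Order.disp_t) (T : tbPOrderType d) (h : T -> nat).
Hypothesis gr : graded n h.

Lemma height_le (x y : T) : x <= y -> (h x <= h y)%N.
Proof.
by rewrite le_eqVlt => /orP[/eqP->//|/(graded_lt gr)/ltnW].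
Qed.

Lemma height_le_max (x : T) : (h x <= n.+1)%N.
Proof. by rewrite -(graded_top gr); apply/height_le/lex1. Qed.

Lemma height_inj_le (x y : T) : x <= y -> h x = h y -> x = y.
Proof.
rewrite le_eqVlt => /orP[/eqP//|/(graded_lt gr)]; lia.
Qed.

Lemma height_le_lt (x y : T) : x <= y -> (h x < h y)%N -> x < y.
Proof.
move=> xy hxy; rewrite lt_neqAle xy andbT.
by apply: contraTneq hxy => ->; rewrite ltnn.
Qed.

Lemma height_eq0 (x : T) : h x = 0%N -> x = \bot.
Proof. by move=> hx; apply/esym/height_inj_le; rewrite ?le0x ?(graded_bot gr). Qed.

Lemma height_eq_max (x : T) : h x = n.+1 -> x = \top.
Proof. by move=> hx; apply/height_inj_le; rewrite ?lex1 ?(graded_top gr). Qed.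

(** Induction on the height difference: an empty open interval is a cover, which leaves only its two
    ends, and otherwise any face strictly between splits the interval into two smaller ones. *)
Lemma interpolate (x y : T) (k : nat) : x <= y -> (h x <= k <= h y)%N ->
  exists2 z, x <= z <= y & h z = k.
Proof.
have [m] := ubnP (h y - h x)%N; elim: m x y => // m IH x y hm xy /andP[xk ky].
have [<-|nxk] := eqVneq (h x) k; first by exists x; rewrite ?lexx.
have [<-|nky] := eqVneq (h y) k; first by exists y; rewrite ?lexx ?andbT.
have xy' : x < y by apply: height_le_lt => //; lia.
have [/(graded_cover gr xy')|/set0P[z /andP[xz zy]]] :=
  eqVneq (between x y) set0; first by lia.
have := graded_lt gr xz; have := graded_lt gr zy => h1 h2.
have [kz|zk] := leqP k (h z).
  have [|||u /andP[xu uz] hu] := IH x z; try by [lia|apply: ltW].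
  by exists u; rewrite // xu (le_trans uz (ltW zy)).
have [|||u /andP[xu uz] hu] := IH z y; try by [lia|apply: ltW].
by exists u; rewrite // uz (le_trans (ltW xz) xu).
Qed.

(** A saturated chain indexed by height. Its values at other indices are arbitrary, so that segments
    can be pasted together. *)
Definition segment (x y : T) (Z : nat -> T) : Prop :=
  [/\ Z (h x) = x, Z (h y) = y,
      forall i, (h x <= i <= h y)%N -> h (Z i) = i
    & forall i, (h x <= i < h y)%N -> Z i <= Z i.+1].

Lemma segment_exists (x y : T) : x <= y -> exists Z, segment x y Z.
Proof.
have [m] := ubnP (h y - h x)%N; elim: m y => // m IH y hm xy.
have [e|nxy] := eqVneq (h x) (h y).
  have <- := height_inj_le xy e.
  by exists (fun=> x); split=> // i; lia.
have hxy := height_le xy.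
have [|z /andP[xz zy] hz] := interpolate (k := (h y).-1) xy; first by lia.
have [|//|Z [Zx Zz Zh Zle]] := IH z; first by lia.
exists (fun i => if i == h y then y else Z i); split => //.
- by case: eqP => // e; rewrite e eqxx in nxy.
- by rewrite eqxx.
- by move=> i hi; case: eqP => [->//|?]; apply: Zh; lia.
move=> i hi; case: eqP => [|_]; first by lia.
case: eqP => [e|?]; last by apply: Zle; lia.
have -> : i = h z by lia.
by rewrite Zz.
Qed.

Lemma segment_cat (x y z : T) (Z W : nat -> T) : x <= y -> y <= z ->
  segment x y Z -> segment y z W ->
  segment x z (fun i => if (i <= h y)%N then Z i else W i).
Proof.
move=> xy yz [Zx Zy Zh Zle] [Wy Wz Wh Wle].
have hxy := height_le xy; have hyz := height_le yz; split.
- by rewrite hxy.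
- case: leqP => // hzy; have e : h y = h z by lia.
  by rewrite -e Zy; apply: height_inj_le.
- by move=> i hi; case: leqP => ?; [apply: Zh | apply: Wh]; lia.
move=> i hi; have [iy|] := ltnP i (h y).
  by rewrite (ltnW iy); apply: Zle; lia.
rewrite leq_eqVlt => /orP[/eqP e|yi].
  by rewrite -e leqnn Zy -{1}Wy; apply: Wle; lia.
by rewrite leqNgt yi /=; apply: Wle; lia.
Qed.

(* A flag is encoded by its sequence of faces, the face of rank [i - 1] having
   index [i]; the sequence is constant from index [n + 1] on. *)
Definition flag_seq (X : nat -> T) : Prop :=
  [/\ forall i, (i <= n.+1)%N -> h (X i) = i,
      forall i, (n.+1 <= i)%N -> X i = \top
    & forall i, X i <= X i.+1].

Lemma flag_seq_le X i j : flag_seq X -> (i <= j)%N -> X i <= X j.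
Proof.
by case=> _ _ le; apply: (homo_leq (r := <=%O)) => //; apply: le_trans.
Qed.

Lemma flag_seq_height X i : flag_seq X -> (i <= n.+1)%N -> h (X i) = i.
Proof. by case=> hX _ _; apply: hX. Qed.

Lemma flag_seq_lt X i j : flag_seq X -> (i < j <= n.+1)%N -> X i < X j.
Proof.
move=> fX hij; apply: height_le_lt; first by apply: flag_seq_le => //; lia.
by rewrite !flag_seq_height //; lia.
Qed.

Lemma flag_seq0 X : flag_seq X -> X 0%N = \bot.
Proof. by move=> fX; apply: height_eq0; rewrite flag_seq_height. Qed.

Lemma flag_seq_segment X a b : flag_seq X -> (a <= b <= n.+1)%N ->
  segment (X a) (X b) X.
Proof.
move=> fX hab; rewrite /segment !flag_seq_height //; try lia; split=> // i hi.
  by rewrite flag_seq_height //; lia.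
by apply: flag_seq_le.
Qed.

Lemma segment_flag_seq X : segment \bot \top X ->
  (forall i, (n.+1 <= i)%N -> X i = \top) -> flag_seq X.
Proof.
rewrite /segment (graded_bot gr) (graded_top gr).
move=> [X0 X1 Xh Xle] Xtop; split=> // i.
have [ni|ni] := leqP n.+1 i; last exact: Xle.
by rewrite !Xtop //; lia.
Qed.

(** Four segments are pasted: [X] up to index [a], a segment from [X a] to [x], one from [x] to
    [X b], and [X] again from index [b] on. *)
Lemma flag_seq_through X a b x : flag_seq X -> (a <= b <= n.+1)%N ->
  X a <= x <= X b ->
  exists Y, [/\ flag_seq Y, agree a b X Y & Y (h x) = x].
Proof.
move=> fX hab /andP[ax xb].
have [Z sZ] := segment_exists ax; have [W sW] := segment_exists xb.
have Xha : h (X a) = a by rewrite flag_seq_height //; lia.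
have Xhb : h (X b) = b by rewrite flag_seq_height //; lia.
have hax := height_le ax; have hxb := height_le xb.
have [X0 Xm] : \bot = X 0%N /\ \top = X n.+1.
  by split; [rewrite flag_seq0|case: fX => _ ->].
have s1 := segment_cat ax xb sZ sW.
have s2 : segment \bot (X a) X.
  by rewrite X0; apply: flag_seq_segment => //; lia.
have s3 : segment (X b) \top X.
  by rewrite Xm; apply: flag_seq_segment => //; lia.
have s4 := segment_cat (le0x _) (le_trans ax xb) s2 s1.
have s5 := segment_cat (le0x _) (lex1 _) s4 s3.
have Xtop : forall i, (n.+1 <= i)%N -> X i = \top by case: fX.
have [Za Zx _ _] := sZ; have [_ Wb _ _] := sW.
eexists; split; first apply: (segment_flag_seq s5).
- move=> i ni; case: ifP => [ib|_]; last exact: Xtop.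
  have ei : i = b by lia.
  rewrite Xha ei; case: leqP => [ba|ba]; first by apply: Xtop; lia.
  rewrite -{3}Xhb Wb; case: leqP => hbx; last by apply: Xtop; lia.
  have e : h x = b by lia.
  by rewrite -{1}e Zx; apply: height_eq_max; lia.
- move=> i; rewrite /inside => hi /=; rewrite Xha Xhb.
  case: leqP => // ib; case: leqP => // ai.
  have -> : i = b by lia.
  case: leqP => bx; last by rewrite -{2}Xhb Wb.
  have e : h x = b by lia.
  by rewrite -{2}e Zx; apply/esym/height_inj_le => //; lia.
rewrite Xha Xhb; have -> : (h x <= b)%N by lia.
rewrite leqnn; case: leqP => // hxa.
by have e : h x = a; [lia|rewrite e; apply: height_inj_le => //; lia].
Qed.

Lemma flag_seq_exists : exists X, flag_seq X.
Proof.
have [Z [Z0 Z1 Zh Zle]] := segment_exists (le0x (\top : T)).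
exists (fun i => if (i <= n)%N then Z i else \top).
apply: segment_flag_seq => [|i]; last by case: leqP => //; lia.
move: Z0 Z1 Zh Zle; rewrite /segment (graded_bot gr) (graded_top gr).
move=> Z0 Z1 Zh Zle; split=> //.
- by rewrite ltnn.
- move=> i hi; case: leqP => ni; first by apply: Zh; lia.
  by rewrite (graded_top gr); lia.
move=> i hi; have -> : (i <= n)%N by lia.
by case: ifP => _; [apply: Zle|apply: lex1].
Qed.

Lemma flag_seq_through2 x y : x <= y ->
  exists X, [/\ flag_seq X, X (h x) = x & X (h y) = y].
Proof.
move=> xy; have [X fX] := flag_seq_exists.
have [|| Y [fY _ Yx]] := @flag_seq_through X 0 n.+1 x fX; first by lia.
  by rewrite flag_seq0 // le0x /=; case: fX => _ -> //; rewrite lex1.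
have hx := height_le_max x; have hxy := height_le xy.
have [||Z [fZ YZ Zy]] := @flag_seq_through Y (h x) n.+1 y fY; first by lia.
  by rewrite Yx xy /=; case: fY => _ -> //; rewrite lex1.
by exists Z; split=> //; rewrite -YZ // /inside; lia.
Qed.

Lemma flag_seq_range X : flag_seq X -> flag (range X).
Proof.
move=> fX; split.
  move=> _ _ [i _ <-] [j _ <-]; have [ij|ji] := leqP i j; [left|right];
    by apply: flag_seq_le => //; lia.
move=> D cD XD; apply/seteqP; split=> // z Dz.
have Xz : D (X (h z)) by apply: XD; exists (h z).
have e : h (X (h z)) = h z by rewrite flag_seq_height // height_le_max.
exists (h z) => //.
by case: (cD _ _ Xz Dz) => le; [|apply: esym]; apply: height_inj_le.
Qed.

Lemma range_mem X x : flag_seq X -> range X x -> X (h x) = x.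
Proof.
move=> fX [i _ <-]; have [ni|ni] := leqP i n.+1.
  by rewrite flag_seq_height.
have [_ Xt _] := fX; rewrite !Xt // ?(graded_top gr) //; lia.
Qed.

Lemma range_inj X Y : flag_seq X -> flag_seq Y -> range X = range Y -> X = Y.
Proof.
move=> fX fY e; apply: funext => i.
have [ni|ni] := leqP n.+1 i; first by case: fX fY => _ -> // _ [_ -> //].
have := @range_mem Y (X i) fY; rewrite -e flag_seq_height //; last by lia.
by move=> -> //; exists i.
Qed.

Lemma chain_height_inj (C : set T) x y : chain C -> C x -> C y -> h x = h y ->
  x = y.
Proof.
move=> cC Cx Cy e; case: (cC _ _ Cx Cy) => le; first exact: height_inj_le.
by apply/esym/height_inj_le.
Qed.

Lemma chain_insert (C : set T) z : flag C ->
  (forall x, C x -> x <= z \/ z <= x) -> C z.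
Proof.
move=> [cC mC] hz; have <- : C `|` [set z] = C; last by right.
apply: mC; last by move=> ?; left.
move=> x y [Cx|->] [Cy|->]; first exact: cC.
- by case: (hz _ Cx); [left|right].
- by case: (hz _ Cy); [right|left].
- by left.
Qed.

Lemma chain_lt (C : set T) x y : chain C -> C x -> C y -> (h x < h y)%N ->
  x < y.
Proof.
move=> cC Cx Cy hxy; case: (cC _ _ Cx Cy) => le; first exact: height_le_lt.
by move/height_le: le; lia.
Qed.

(** If a maximal chain missed height [i], take its faces [x] and [y] closest to that height from
    below and above. Their heights differ by at least 2, so some [z] lies strictly between them; it
    is comparable with the whole chain, hence belongs to it, against the choice of [x] and [y]. *)
Lemma flag_height (C : set T) i : flag C -> (i <= n.+1)%N ->
  exists2 x, C x & h x = i.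
Proof.
move=> fC hi; have [cC mC] := fC.
have C0 : C \bot by apply: chain_insert => // x _; right; apply: le0x.
have C1 : C \top by apply: chain_insert => // x _; left; apply: lex1.
apply: contrapT => no.
have noi x : C x -> h x != i by move=> Cx; apply/eqP => e; apply: no; exists x.
have exlo : exists k, `[< exists2 x, C x & h x = k /\ (k < i)%N >].
  exists 0%N; apply/asboolP; exists \bot => //; split; first exact: graded_bot gr.
  by have := noi _ C0; rewrite (graded_bot gr) eq_sym lt0n.
have exhi : exists k, `[< exists2 x, C x & h x = k /\ (i < k)%N >].
  exists n.+1; apply/asboolP; exists \top => //; split; first exact: graded_top gr.
  by have := noi _ C1; rewrite (graded_top gr); lia.
have blo k : `[< exists2 x, C x & h x = k /\ (k < i)%N >] -> (k <= i)%N.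
  by move/asboolP => [x _ [_ /ltnW]].
case: (ex_maxnP exlo blo) => p /asboolP[x Cx [xp pi]] maxp.
case: (ex_minnP exhi) => q /asboolP[y Cy [yq iq]] minq.
have xy : x < y by apply: (chain_lt cC) => //; lia.
have [/(graded_cover gr xy)|/set0P[z /andP[xz zy]]] :=
  eqVneq (between x y) set0; first by lia.
have Cz : C z.
  apply: chain_insert => // u Cu; have := noi _ Cu; rewrite neq_lt => /orP[ui|iu].
    left; apply: le_trans (ltW xz).
    have : (h u <= p)%N by apply: maxp; apply/asboolP; exists u.
    case: (cC _ _ Cu Cx) => // xu; have := height_le xu => h1 h2.
    by have -> // : x = u; apply: height_inj_le => //; lia.
  right; apply: le_trans (ltW zy) _.
  have : (q <= h u)%N by apply: minq; apply/asboolP; exists u.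
  case: (cC _ _ Cu Cy) => // uy; have := height_le uy => h1 h2.
  by have -> // : u = y; apply: height_inj_le => //; lia.
have := noi _ Cz; rewrite neq_lt => /orP[zi|iz].
  have := graded_lt gr xz.
  have : (h z <= p)%N by apply: maxp; apply/asboolP; exists z.
  lia.
have := graded_lt gr zy.
have : (q <= h z)%N by apply: minq; apply/asboolP; exists z.
lia.
Qed.

Lemma flagP (C : set T) : flag C -> exists2 X, flag_seq X & range X = C.
Proof.
move=> fC; have [cC mC] := fC.
(* The default [\top] produces the constant tail, since no face has height above [n.+1]. *)
pose X i := xget \top [set x | C x /\ h x = i].
have hX i : (i <= n.+1)%N -> C (X i) /\ h (X i) = i.
  move=> /(flag_height fC)[x Cx hx].
  exact: (@xgetI _ \top [set x | C x /\ h x = i] x (conj Cx hx)).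
have Xtop i : (n.+1 <= i)%N -> X i = \top.
  rewrite leq_eqVlt => /orP[/eqP<-|ni].
    by apply: height_eq_max; case: (hX n.+1).
  by apply: xgetPN => x [_ hx]; have := height_le_max x; lia.
have fX : flag_seq X.
  split=> [i /hX[]//|//|i]; have [ni|ni] := ltnP i n.+1; last first.
    by rewrite (Xtop i.+1) ?lex1 //; lia.
  have [Ci hi] := hX i (ltnW ni); have [Ci1 hi1] := hX _ ni.
  by apply/ltW/(chain_lt cC) => //; rewrite hi hi1.
exists X => //; apply/esym/(proj2 (flag_seq_range fX)) => // _ [i _ <-].
have [ni|ni] := leqP i n.+1; first by case: (hX i ni).
by rewrite Xtop ?(ltnW ni) // -(Xtop n.+1) //; case: (hX n.+1).
Qed.

Lemma flag_card (C : set T) : flag C -> C #= `I_n.+2.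
Proof.
move=> /flagP[X fX <-].
have -> : range X = X @` `I_n.+2.
  apply/seteqP; split=> y [i hi <-]; last by exists i.
  have [ni|ni] := ltnP i n.+2; first by exists i.
  by exists n.+1; [exact: ltnSn|]; have [_ Xt _] := fX; rewrite !Xt //; lia.
apply: inj_card_eq => i j; rewrite !inE /= => hi hj e.
by rewrite -(flag_seq_height fX hi) e flag_seq_height.
Qed.

Lemma automorphism_flag_seq f X : automorphism f -> flag_seq X ->
  flag_seq (f \o X).
Proof.
move=> [bf mf] fX.
have lef x y : x <= y -> f x <= f y by rewrite mf.
have ltf x y : x < y -> f x < f y by rewrite !lt_leAnge !mf.
have mono i : (i <= n.+1)%N -> (i <= h (f (X i)))%N.
  elim: i => // i IH ni; have := IH (ltnW ni) => /leq_ltn_trans; apply.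
  by apply/(graded_lt gr)/ltf/flag_seq_lt => //; rewrite ltnSn.
have anti k : (k <= n.+1)%N -> (h (f (X (n.+1 - k))) <= n.+1 - k)%N.
  elim: k => [_|k IH nk]; first by rewrite subn0 height_le_max.
  have := IH (ltnW nk); apply: contraTT; rewrite -!ltnNge => hk.
  have : f (X (n.+1 - k.+1)%N) < f (X (n.+1 - k)%N).
    by apply/ltf/flag_seq_lt => //; lia.
  by move/(graded_lt gr); lia.
have hf i : (i <= n.+1)%N -> h (f (X i)) = i.
  move=> ni; apply/eqP; rewrite eqn_leq mono // andbT.
  by have := anti (n.+1 - i)%N (leq_subr _ _); rewrite subKn.
split=> [i /hf//|i ni|i]; last by apply/lef/flag_seq_le.
have [_ Xt _] := fX; rewrite /= Xt //.
by apply: height_eq_max; rewrite -(Xt n.+1) // hf.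
Qed.

End Graded.

(** * Flips and the action of words on flags *)

Definition height (T : Type) (rk : T -> int) (x : T) : nat :=
  `|(rk x + 1)%R|%N.

(** For [0 < j < n.+1] the diamond condition leaves exactly one candidate for the new face; the
    default [X j] makes the operator total. *)
Definition flip (d : Order.disp_t) (T : porderType d) (j : nat)
    (X : nat -> T) : nat -> T :=
  fun i => if i == j then
    xget (X j) [set y | X j.-1 < y < X j.+1 /\ y <> X j] else X i.

(** Letters are applied from left to right, so that concatenation of words is a right action. *)
Definition act (d : Order.disp_t) (T : porderType d) (X : nat -> T)
    (w : seq nat) : nat -> T :=
  foldl (fun Y j => flip j Y) X w.

Section FlagAction.
Variables (n : nat) (d : Order.disp_t) (T : tbPOrderType d) (rk : T -> int).
Hypothesis P : polytope n rk.
Implicit Types (X Y Z : nat -> T) (w : seq nat).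
Local Notation h := (height rk).
Local Notation flag_seq := (flag_seq n h).

Lemma height_rank (x : T) : ((h x)%:Z = rk x + 1)%R.
Proof.
suff : (-1 <= rk x)%R by rewrite /height; lia.
have := le0x x; rewrite le_eqVlt -(polytope_rank_bot P) => /orP[/eqP->//|].
by move/(polytope_rank_lt P)/ltW.
Qed.

Lemma polytope_graded : graded n h.
Proof.
split.
- by rewrite /height (polytope_rank_bot P).
- by rewrite /height (polytope_rank_top P); lia.
- move=> x y /(polytope_rank_lt P).
  by have := height_rank x; have := height_rank y; lia.
- move=> x y xy /(polytope_rank_cover P xy).
  by have := height_rank x; have := height_rank y; lia.
Qed.

Let gr := polytope_graded.

Lemma diamond (x y z : T) : h y = (h x).+2 -> x < z < y ->
  exists2 z', x < z' < y /\ z' <> z & forall u, x < u < y -> u = z \/ u = z'.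
Proof.
move=> hxy xzy; have xy : x < y by case/andP: xzy; apply: lt_trans.
have rkxy : rk y = (rk x + 2)%R.
  by have := height_rank x; have := height_rank y; lia.
have /card_set_bijP[f [ff fi fs]] := polytope_diamond P xy rkxy.
have fz : (f z < 2)%N by apply: ff.
(* The bijection [f] onto [I_2] takes the values 0 and 1, so [1 - f z] is the value of the other
   face. *)
have [z' xzy' fz'] : (f @` between x y) (1 - f z)%N by apply: fs => /=; lia.
exists z'; first by split=> // e; move: fz'; rewrite e; lia.
move=> u xuy; have fu : (f u < 2)%N by apply: ff.
have [e|e] := eqVneq (f u) (f z); [left|right]; apply: fi; rewrite ?inE //.
by rewrite fz'; lia.
Qed.


Lemma flip_spec X j : flag_seq X -> inside 0 n.+1 j ->
  [/\ X j.-1 < flip j X j < X j.+1, flip j X j <> X j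
    & forall u, X j.-1 < u < X j.+1 -> u = X j \/ u = flip j X j].
Proof.
move=> fX; rewrite /inside => hj.
have XjX : X j.-1 < X j < X j.+1.
  by apply/andP; split; apply: (flag_seq_lt fX); lia.
have [|z' [xzy' nz'] uz'] := diamond _ XjX.
  by rewrite !(flag_seq_height fX); lia.
rewrite /flip eqxx.
have [a b] := @xgetI _ (X j) [set y | X j.-1 < y < X j.+1 /\ y <> X j] z'
  (conj xzy' nz').
split=> // u /uz'[->|->]; first by left.
by case: (uz' _ a) => // e; right.
Qed.

Lemma flip_off X j i : i != j -> flip j X i = X i.
Proof. by rewrite /flip => /negPf ->. Qed.

Lemma flip_flag X j : flag_seq X -> inside 0 n.+1 j -> flag_seq (flip j X).
Proof.
move=> fX jn; have [/andP[lo hi] _ _] := flip_spec fX jn.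
have [Xh Xt Xle] := fX.
have jn' : (0 < j < n.+1)%N by [].
split.
- move=> i ni; have [->|ij] := eqVneq i j; last by rewrite flip_off // Xh.
  have := graded_lt gr lo; have := graded_lt gr hi.
  by rewrite !Xh; lia.
- by move=> i ni; rewrite flip_off ?Xt //; apply/eqP; lia.
- move=> i; have [e|ij] := eqVneq i j.
    by rewrite e (flip_off _ (i := j.+1)) ?ltW //; lia.
  rewrite (flip_off _ ij).
  have [e|ij1] := eqVneq i.+1 j; last by rewrite flip_off.
  by rewrite e; move: lo; rewrite -e /= => /ltW.
Qed.

(** [Y j] lies between the same two neighbours as [X j], and the diamond has only one other face.
    Identities between flips are checked through this characterization. *)
Lemma flip_unique X Y j : flag_seq X -> flag_seq Y -> inside 0 n.+1 j ->
  (forall i, i != j -> Y i = X i) -> Y j <> X j -> Y = flip j X.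
Proof.
move=> fX fY jn YX Yj; apply: funext => i.
have jn' : (0 < j < n.+1)%N by [].
have [->|ij] := eqVneq i j; last by rewrite flip_off ?YX.
have [_ _ /(_ (Y j))[||//]] := flip_spec fX jn; last by [].
by rewrite -!YX; [apply/andP; split; apply: (flag_seq_lt fY)|..]; lia.
Qed.

Lemma flipK X j : flag_seq X -> inside 0 n.+1 j -> flip j (flip j X) = X.
Proof.
move=> fX jn; apply/esym/flip_unique => //; first exact: flip_flag.
  by move=> i ij; rewrite flip_off.
by apply: nesym; case: (flip_spec fX jn).
Qed.

(** A flip depends only on the faces at its index and at the two neighbouring ones, none of which is
    touched by a flip at distance at least 2. *)
Lemma flipC X i j : flag_seq X -> inside 0 n.+1 i -> inside 0 n.+1 j ->
  (i.+1 < j)%N || (j.+1 < i)%N -> flip i (flip j X) = flip j (flip i X).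
Proof.
move=> fX ni nj; rewrite /inside in ni nj * => ij.
apply: flip_unique => //; try by do ?apply: flip_flag.
  move=> k kj; have [->|ki] := eqVneq k i; last by rewrite !flip_off.
  have e k' : (i.-1 <= k' <= i.+1)%N -> flip j X k' = X k'.
    by move=> ?; rewrite flip_off //; apply/eqP; lia.
  by rewrite /flip eqxx -!/(flip _ _ _) !e //; lia.
rewrite !(@flip_off _ i); try by apply/eqP; lia.
by case: (flip_spec fX nj).
Qed.

Lemma flip_auto f X j : automorphism f -> flag_seq X -> inside 0 n.+1 j ->
  f \o flip j X = flip j (f \o X).
Proof.
move=> af fX nj; apply: flip_unique => //.
- exact: automorphism_flag_seq.
- by apply: automorphism_flag_seq => //; apply: flip_flag.
- by move=> i ij /=; rewrite flip_off.
move=> /= /(bij_inj (proj1 af)).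
by case: (flip_spec fX nj).
Qed.

Lemma inside_sub a b a' b' w : (a' <= a)%N -> (b <= b')%N ->
  all (inside a b) w -> all (inside a' b') w.
Proof.
move=> ha hb; apply: sub_all => i; rewrite /inside; lia.
Qed.

Lemma act_cat X u v : act X (u ++ v) = act (act X u) v.
Proof. exact: foldl_cat. Qed.

Lemma act_flag X w : flag_seq X -> all (inside 0 n.+1) w -> flag_seq (act X w).
Proof.
elim: w X => // j w IH X fX /= /andP[nj nw].
by apply: IH => //; apply: flip_flag.
Qed.

Lemma act_agree a b X w : all (inside a b) w -> agree a b X (act X w).
Proof.
elim: w X => // j w IH X /= /andP[nj nw] i ni.
rewrite -(IH _ nw i ni) flip_off //.
by apply: contraNneq ni => ->.
Qed.

Lemma act_revK X w : flag_seq X -> all (inside 0 n.+1) w ->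
  act (act X w) (rev w) = X.
Proof.
elim: w X => // j w IH X fX /= /andP[nj nw].
rewrite rev_cons -cats1 act_cat IH //; last exact: flip_flag.
exact: flipK.
Qed.

Lemma act_auto f X w : automorphism f -> flag_seq X ->
  all (inside 0 n.+1) w -> f \o act X w = act (f \o X) w.
Proof.
move=> af; elim: w X => // j w IH X fX /= /andP[nj nw].
by rewrite IH ?flip_auto //; apply: flip_flag.
Qed.

Lemma act_flipC X w j : flag_seq X -> inside 0 n.+1 j ->
  all (inside 0 n.+1) w -> all (fun i => (i.+1 < j) || (j.+1 < i))%N w ->
  act (flip j X) w = flip j (act X w).
Proof.
move=> + nj; elim: w X => // i w IH X fX /= /andP[ni nw] /andP[ij wj].
by rewrite flipC // IH //; apply: flip_flag.
Qed.

(** * Strong connectivity expressed through flips *)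

Lemma agree_sym a b (X Y : nat -> T) : agree a b X Y -> agree a b Y X.
Proof. by move=> XY i /XY. Qed.

Lemma agree_trans a b (X Y Z : nat -> T) :
  agree a b X Y -> agree a b Y Z -> agree a b X Z.
Proof. by move=> XY YZ i hi; rewrite XY ?YZ. Qed.

Lemma flag_splice X Y i : flag_seq X -> flag_seq Y -> X i = Y i ->
  flag_seq (fun j => if (j <= i)%N then X j else Y j).
Proof.
move=> fX fY e; split.
- by move=> j nj; case: ifP => _; rewrite (flag_seq_height _ nj).
- by move=> j nj; have [_ Xt _] := fX; have [_ Yt _] := fY; rewrite Xt // Yt // if_same.
move=> j; have [ji|ij|->] := ltngtP j i.
- exact: flag_seq_le fX _.
- exact: flag_seq_le fY _.
by rewrite e; apply: flag_seq_le fY _.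
Qed.

Definition connected (a b : nat) : Prop := forall X Y,
  flag_seq X -> flag_seq Y -> agree a b X Y ->
  exists2 w, all (inside a b) w & Y = act X w.

(** The intermediate flag follows [Y] up to index [i] and [X] beyond it; each half of the way then
    takes place in a smaller section. *)
Lemma connected_at a b i X Y : (a <= i <= b)%N ->
  connected a i -> connected i b ->
  flag_seq X -> flag_seq Y -> agree a b X Y -> X i = Y i ->
  exists2 w, all (fun j => inside a b j && (j != i)) w & Y = act X w.
Proof.
rewrite /inside => ai c1 c2 fX fY XY e.
have fZ := flag_splice fY fX (esym e).
have [|w hw eZ] := c1 X _ fX fZ.
  move=> j; rewrite /inside => hj; case: leqP => // ji.
  have [->//|nji] := eqVneq j i; by apply: XY; rewrite /inside; lia.
have [|v hv eY] := c2 _ Y fZ fY.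
  move=> j; rewrite /inside => hj; case: leqP => // ji.
  by apply: XY; rewrite /inside; lia.
exists (w ++ v); last by rewrite act_cat -eZ.
by rewrite all_cat; apply/andP; split; [apply: sub_all hw|apply: sub_all hv];
  move=> j; rewrite /inside; lia.
Qed.

(** Induction on [b - a]. A gap of at most 1 leaves nothing to change and a gap of 2 at most one
    flip. For larger gaps, strong connectivity gives a path of faces from [X a.+1] to [Y a.+1], and
    flags through consecutive faces of the path are linked in turn. *)
Lemma flag_connected a b : (b <= n.+1)%N -> connected a b.
Proof.
have [m] := ubnP (b - a)%N; elim: m a b => // m IH a b hm bn X Y fX fY XY.
have [ba|ab] := leqP b a.+1.
  by exists [::] => //; apply: funext => i; rewrite /= XY // /inside; lia.
have [e|b3] := eqVneq b a.+2.
  have [e1|ne1] := eqVneq (Y a.+1) (X a.+1).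
    exists [::] => //; apply: funext => i /=.
    by have [->//|ni] := eqVneq i a.+1; rewrite XY // /inside; lia.
  exists [:: a.+1]; first by rewrite /= /inside; lia.
  apply: flip_unique => //; first by rewrite /inside; lia.
    by move=> i ni; rewrite XY // /inside; lia.
  exact/eqP.
have Xab : X a < X b by apply: (flag_seq_lt fX); lia.
have ha : h (X a) = a by rewrite (flag_seq_height fX) //; lia.
have hb : h (X b) = b by rewrite (flag_seq_height fX) //; lia.
have rab : (rk (X a) + 3 <= rk (X b))%R.
  by have := height_rank (X a); have := height_rank (X b); lia.
have Ha : between (X a) (X b) (X a.+1).
  by apply/andP; split; apply: (flag_seq_lt fX); lia.
have Ka : between (X a) (X b) (Y a.+1).
  rewrite !XY; try by rewrite /inside; lia.
  by apply/andP; split; apply: (flag_seq_lt fY); lia.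
have [l [p [p0 pl pb ps]]] := polytope_strongly_connected P Xab rab Ha Ka.
have inab i : (i <= l)%N -> inside a b (h (p i)).
  move=> /pb/andP[/(graded_lt gr) + /(graded_lt gr)].
  by rewrite /inside ha hb => -> ->.
(* Two flags sharing an inner face are linked by the induction hypothesis on either side of that
   face. *)
have at_ i Z Z' : inside a b i -> flag_seq Z -> flag_seq Z' -> agree a b Z Z' ->
    Z i = Z' i -> exists2 w, all (inside a b) w & Z' = act Z w.
  move=> /andP[ai ib] fZ fZ' ZZ' e.
  have aib : (a <= i <= b)%N by lia.
  have c1 : connected a i by apply: IH; lia.
  have c2 : connected i b by apply: IH; lia.
  have [w hw ->] := connected_at aib c1 c2 fZ fZ' ZZ' e.
  by exists w => //; apply: sub_all hw => j /andP[].
have reach i : (i <= l)%N ->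
    exists2 w, all (inside a b) w & act X w (h (p i)) = p i.
  elim: i => [_|i IHi il].
    by exists [::]; rewrite //= p0 (flag_seq_height fX) //; lia.
  have [w hw ew] := IHi (ltnW il).
  have fw : flag_seq (act X w) by apply: act_flag => //; apply: inside_sub hw.
  have comp : p i <= p i.+1 \/ p i.+1 <= p i.
    by have := ps _ il; case: ifP; [right|left].
  have Xw := act_agree X hw.
  (* A flag through both [p i] and [p i.+1]: the current one is rerouted above or below [p i],
     according to the direction of the step. *)
  have [Z [fZ XZ Zi Zi1]] : exists Z, [/\ flag_seq Z, agree a b (act X w) Z,
      Z (h (p i)) = p i & Z (h (p i.+1)) = p i.+1].
    have /andP[ai1 bi1] := pb _ il.
    have := inab _ (ltnW il); rewrite /inside => hi.
    have := inab _ il; rewrite /inside => hi1.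
    case: comp => le.
      have [||Z [fZ XZ Zi1]] :=
        @flag_seq_through _ _ _ _ gr (act X w) (h (p i)) b (p i.+1) fw.
      - by lia.
      - by rewrite ew le /= -Xw ?ltW // /inside; lia.
      exists Z; split=> //; last by rewrite -XZ // /inside; lia.
      by move=> k hk; apply: XZ; move: hk; rewrite /inside; lia.
    have [||Z [fZ XZ Zi1]] :=
      @flag_seq_through _ _ _ _ gr (act X w) a (h (p i)) (p i.+1) fw.
    - by lia.
    - by rewrite ew le andbT -Xw ?ltW // /inside; lia.
    exists Z; split=> //; last by rewrite -XZ // /inside; lia.
    by move=> k hk; apply: XZ; move: hk; rewrite /inside; lia.
  have [|v hv eZ] := at_ _ _ _ (inab _ (ltnW il)) fw fZ XZ.
    by rewrite Zi ew.
  by exists (w ++ v); rewrite ?all_cat ?hw // act_cat -eZ.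
have [w hw ew] := reach l (leqnn _).
have fw : flag_seq (act X w) by apply: act_flag => //; apply: inside_sub hw.
have hl : h (p l) = a.+1 by rewrite pl (flag_seq_height fY) //; lia.
rewrite hl pl in ew.
have [|||v hv eY] := at_ a.+1 _ _ _ fw fY => //.
- by rewrite /inside; lia.
- by apply: agree_trans (agree_sym (act_agree X hw)) XY.
by exists (w ++ v); rewrite ?all_cat ?hw // act_cat -eY.
Qed.

Lemma flag_agree X Y : flag_seq X -> flag_seq Y -> agree 0 n.+1 X Y.
Proof.
move=> fX fY j; rewrite /inside => hj; have [j0|nj] := posnP j.
  by rewrite j0 (flag_seq0 gr fX) (flag_seq0 gr fY).
have [_ Xt _] := fX; have [_ Yt _] := fY.
by rewrite Xt ?Yt //; lia.
Qed.

(** Flags with a common face are linked without ever moving that face; this makes maps defined face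
    by face from words well defined. *)
Lemma connected_avoiding X Y i : flag_seq X -> flag_seq Y -> (i <= n.+1)%N ->
  X i = Y i ->
  exists w, [/\ all (inside 0 n.+1) w, all (predC1 i) w & Y = act X w].
Proof.
move=> fX fY hi e.
have c1 : connected 0 i by apply: flag_connected.
have c2 : connected i n.+1 by apply: flag_connected.
have XY := flag_agree fX fY.
have [w hw ->] := @connected_at 0 n.+1 i X Y hi c1 c2 fX fY XY e.
by exists w; split=> //; apply: sub_all hw => j /andP[].
Qed.

Lemma act_avoiding X w i : all (predC1 i) w -> act X w i = X i.
Proof.
elim: w X => //= j w IH X /andP[ji wi].
by rewrite IH // flip_off // eq_sym.
Qed.

(** * Uniform regularity of sections *)

Lemma act_eq_rev X Y w : flag_seq X -> all (inside 0 n.+1) w ->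
  act X w = Y -> X = act Y (rev w).
Proof. by move=> fX hw <-; rewrite act_revK. Qed.

Lemma act_rev_eq X Y w : flag_seq Y -> all (inside 0 n.+1) w ->
  X = act Y (rev w) -> act X w = Y.
Proof.
move=> fY hw ->; have := act_revK fY (w := rev w); rewrite revK all_rev.
by apply.
Qed.

(* All sections between a face of rank [a - 1] and a face of rank [b - 1] are
   regular and isomorphic to each other. *)
Definition uniformly_regular (a b : nat) : Prop :=
  forall w, all (inside a b) w -> forall X Y, flag_seq X -> flag_seq Y ->
    act X w = X -> act Y w = Y.

Lemma uniformly_regular_sub a b a' b' : (a <= a')%N -> (b' <= b)%N ->
  uniformly_regular a b -> uniformly_regular a' b'.
Proof. by move=> ha hb reg w hw; apply: reg; apply: inside_sub hw. Qed.

(** Regularity is applied to [u ++ rev v], so that a relation between two words read off at one flag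
    holds at every flag. *)
Lemma uniformly_regular_act a b u v X Y : (b <= n.+1)%N ->
  uniformly_regular a b -> all (inside a b) u -> all (inside a b) v ->
  flag_seq X -> flag_seq Y -> act X u = act X v -> act Y u = act Y v.
Proof.
move=> bn reg hu hv fX fY e.
have hv0 := inside_sub (leq0n a) bn hv; have hu0 := inside_sub (leq0n a) bn hu.
apply/esym/act_rev_eq => //; first exact: act_flag.
rewrite -act_cat; apply/esym/(reg _ _ X) => //.
  by rewrite all_cat hu all_rev.
by rewrite act_cat e act_revK.
Qed.

(* Flatness rewrites a word in the letters above [a + 1] as a word fixing the
   face of index [b - 1] followed by one commuting with the flip at [a + 1],
   so that every word is a facet word followed by a vertex-figure word. *)
Lemma uniformly_regular_extend a b : (a + 5 <= b <= n.+1)%N ->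
  (forall x y : T, (h x + 2 <= h y)%N -> x <= y) ->
  uniformly_regular a b.-1 -> uniformly_regular a.+1 b ->
  uniformly_regular a b.
Proof.
move=> /andP[ab bn] flat reg1 reg2.
have top w c e : (e <= b)%N -> all (inside c e) w -> all (inside 0 n.+1) w.
  by move=> ?; apply: inside_sub => //; lia.
have fact w : all (inside a b) w -> exists u v,
    [/\ all (inside a b.-1) u, all (inside a.+1 b) v
      & forall X, flag_seq X -> act X w = act X (u ++ v)].
  elim/last_ind: w => [_|w j IH]; first by exists [::], [::].
  rewrite all_rcons => /andP[hj /IH[u [v [hu hv e]]]].
  have hu0 := top _ _ _ (leq_pred b) hu; have hv0 := top _ _ _ (leqnn b) hv.
  have [aj|ja] := ltnP a.+1 j.
    exists u, (rcons v j); split=> //.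
      by rewrite all_rcons hv andbT; move: hj; rewrite /inside; lia.
    by move=> X fX; rewrite -!cats1 !act_cat e // act_cat.
  have ej : j = a.+1 by move: hj; rewrite /inside; lia.
  subst j.
  have [X0 fX0] := flag_seq_exists gr.
  pose Y := act X0 v; have fY : flag_seq Y by apply: act_flag.
  have X0Y : agree a.+1 b X0 Y by apply: act_agree.
  (* [Z] keeps the face [X0 b.-1] but passes through [Y a.+2]. Flatness makes these two faces
     incident, and [a + 5 <= b] is exactly the required gap of heights. *)
  have [||Z [fZ X0Z Za]] :=
    @flag_seq_through _ _ _ _ gr X0 a.+1 b.-1 (Y a.+2) fX0.
  - by lia.
  - rewrite X0Y; last by rewrite /inside; lia.
    rewrite (flag_seq_le fY) //=; apply: flat.
    by rewrite (flag_seq_height fY) ?(flag_seq_height fX0); lia.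
  rewrite (flag_seq_height fY) in Za; last by lia.
  have bn1 : (b.-1 <= n.+1)%N by lia.
  have [m hm em] := flag_connected bn1 fX0 fZ X0Z.
  have [|c hc ec] := flag_connected bn fZ fY (a := a.+2).
    move=> i hi; have [->//|ni] := eqVneq i a.+2.
    have [ib|bi] := ltnP i b.
      rewrite -X0Z ?X0Y //; move: hi; rewrite /inside; lia.
    by rewrite -X0Z ?X0Y //; move: hi; rewrite /inside; lia.
  have hm0 := top _ _ _ (leq_pred b) hm; have hc0 := top _ _ _ (leqnn b) hc.
  exists (u ++ m ++ [:: a.+1]), c; split.
  - rewrite !all_cat hu (inside_sub _ _ hm) //= /inside; lia.
  - by apply: inside_sub hc.
  move=> X fX; rewrite -cats1 !act_cat e // act_cat.
  have fXu : flag_seq (act X u) by apply: act_flag.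
  (* The words [v] and [m ++ c] are known to agree at [X0]; [reg2] carries this to the present
     flag. *)
  have -> : act (act X u) v = act (act X u) (m ++ c).
    apply: (uniformly_regular_act bn reg2 hv) fX0 _ _ => //.
      by rewrite all_cat (inside_sub _ _ hm) ?(inside_sub _ _ hc) //; lia.
    by rewrite act_cat -em -ec.
  rewrite act_cat /= act_flipC //.
  - exact: act_flag.
  - by rewrite /inside; lia.
  - by apply: sub_all hc => i; rewrite /inside; lia.
move=> w /fact[u [v [hu hv e]]] X Y fX fY.
have hu0 := top _ _ _ (leq_pred b) hu; have hv0 := top _ _ _ (leqnn b) hv.
rewrite !e // !act_cat => /act_eq_rev eX.
have {}eX : act X u = act X (rev v) by apply: eX => //; apply: act_flag.
have fXu : flag_seq (act X u) by apply: act_flag.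
have bn1 : (b.-1 <= n.+1)%N by lia.
have rv : all (inside a.+1 b) (rev v) by rewrite all_rev.
(* The flag [act X u], also equal to [act X (rev v)], differs from [X] only at indices available to
   both kinds of words. One word [m] in these common letters reaches it, and [reg1] and [reg2] carry
   the agreement of [m] with [u] and with [rev v] over to [Y]. *)
have [|m hm em] := flag_connected bn1 fX fXu (a := a.+1).
  move=> i hi; have [ia|ai] := leqP i a.+1.
    by rewrite eX; apply: (act_agree X rv); rewrite /inside; lia.
  by apply: (act_agree X hu); move: hi; rewrite /inside; lia.
have e1 : act Y u = act Y m.
  by apply: (uniformly_regular_act bn1 reg1 hu _ fX) => //; apply: inside_sub hm.
have e2 : act Y (rev v) = act Y m.
  apply: (uniformly_regular_act bn reg2 rv _ fX) => //; last by rewrite -eX.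
  by apply: inside_sub hm => //; lia.
by apply: act_rev_eq => //; rewrite e1.
Qed.

(** * Automorphism orbits and adjacency of flags *)

Lemma orbit_eq_range X Y : flag_seq X -> flag_seq Y ->
  same_orbit (range X) (range Y) -> orbit_eq X Y.
Proof.
move=> fX fY [f af e]; exists f => //.
apply: (range_inj gr) => //; first exact: automorphism_flag_seq.
by rewrite -e image_comp.
Qed.

Lemma same_orbit_range X Y : orbit_eq X Y -> same_orbit (range X) (range Y).
Proof. by move=> [f af <-]; exists f => //; rewrite image_comp. Qed.

Lemma adjacent_flip X j : flag_seq X -> inside 0 n.+1 j ->
  adjacent (range X) (range (flip j X)).
Proof.
move=> fX nj; have fY := flip_flag fX nj.
have [_ ne _] := flip_spec fX nj.
have hj : (j <= n.+1)%N by case/andP: nj => _ /ltnW.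
exists (X j), (flip j X j); split; apply/seteqP; split=> x /=.
- move=> [[i _ <-] no]; have [->//|ij] := eqVneq i j.
  by case: no; exists i => //; rewrite flip_off.
- move=> ->; split; first by exists j.
  by move=> /(range_mem gr fY); rewrite (flag_seq_height fX).
- move=> [[i _ <-] no]; have [->//|ij] := eqVneq i j.
  by case: no; exists i => //; rewrite flip_off.
- move=> ->; split; first by exists j.
  by move=> /(range_mem gr fX); rewrite (flag_seq_height fY) // => /esym.
Qed.

End FlagAction.

Lemma automorphism_comp (d : Order.disp_t) (T : porderType d) (f g : T -> T) :
  automorphism f -> automorphism g -> automorphism (f \o g).
Proof.
move=> [bf mf] [bg mg]; split; first exact: bij_comp.
by move=> x y /=; rewrite mf mg.
Qed.

Lemma automorphism_inverse (d : Order.disp_t) (T : porderType d) (f : T -> T) :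
  automorphism f -> exists g, [/\ automorphism g, cancel f g & cancel g f].
Proof.
move=> [[g fK gK] mf]; exists g; split=> //; split; first by exists f.
by move=> x y; rewrite -mf !gK.
Qed.

Lemma same_orbit_sym (d : Order.disp_t) (T : porderType d) (C D : set T) :
  same_orbit C D -> same_orbit D C.
Proof.
move=> [f /automorphism_inverse[g [ag fK gK]] <-]; exists g => //.
rewrite image_comp; have -> : g \o f = id by apply: funext.
exact: image_id.
Qed.

Lemma same_orbit_trans (d : Order.disp_t) (T : porderType d) (C D E : set T) :
  same_orbit C D -> same_orbit D E -> same_orbit C E.
Proof.
move=> [f af <-] [g ag <-]; exists (g \o f); first exact: automorphism_comp.
by rewrite image_comp.
Qed.

Section PolytopeOrbits.
Variables (n : nat) (d : Order.disp_t) (T : tbPOrderType d) (rk : T -> int).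
Hypothesis P : polytope n rk.
Local Notation h := (height rk).
Local Notation flag_seq := (flag_seq n h).
Implicit Types (X Y Z : nat -> T) (w : seq nat).

Let gr := polytope_graded P.

(** Automorphisms commute with the action of words, so stabilizers are constant along orbits. *)
Lemma orbit_act X Y w : flag_seq X -> all (inside 0 n.+1) w -> orbit_eq X Y ->
  act X w = X <-> act Y w = Y.
Proof.
move=> fX hw [f af <-]; rewrite -(act_auto P) //; split=> [->//|e].
apply: funext => i; apply: (bij_inj (proj1 af)).
exact: (congr1 (@^~ i) e).
Qed.

Lemma adjacent_flipP X Y : flag_seq X -> flag_seq Y ->
  adjacent (range X) (range Y) ->
  exists2 i, inside 0 n.+1 i & Y = flip i X.
Proof.
move=> fX fY [x [_ [eX _]]].
have [[i0 _ xi] xY] : (range X `\` range Y)%classic x by rewrite eX.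
have Xx : X (h x) = x by apply: (range_mem gr fX); exists i0.
have neq : Y (h x) <> X (h x).
  by move=> e; apply: xY; exists (h x); rewrite // e.
have hx : inside 0 n.+1 (h x).
  by apply/negPn/negP => /(flag_agree P fX fY) e; apply: neq.
exists (h x) => //; apply: (flip_unique P) => // k kx.
have [nk|kn] := ltnP n.+1 k.
  by apply/esym/(flag_agree P fX fY); rewrite /inside; lia.
have hXk : h (X k) = k by rewrite (flag_seq_height fX).
have : range Y (X k).
  apply: contrapT => no.
  have : (range X `\` range Y)%classic (X k) by split=> //; exists k.
  by rewrite eX => e; move: kx; rewrite -e hXk eqxx.
by move=> /(range_mem gr fY); rewrite hXk.
Qed.

End PolytopeOrbits.

(** * Regular sections of a chiral polytope *)

Section ChiralRegularity.
Variables (n : nat) (d : Order.disp_t) (T : tbPOrderType d) (rk : T -> int).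
Hypothesis C : chiral_polytope n rk.
Local Notation h := (height rk).
Local Notation flag_seq := (flag_seq n h).
Implicit Types (X Y Z : nat -> T) (w : seq nat).

Let P : polytope n rk. Proof. by case: C. Qed.
Let gr := polytope_graded P.

Lemma chiral_flip X j : flag_seq X -> inside 0 n.+1 j ->
  ~ orbit_eq X (flip j X).
Proof.
move=> fX nj; have [_ _ adj] := C; have fY := flip_flag P fX nj.
move=> /same_orbit_range.
apply: adj; last exact: (adjacent_flip P).
- exact: flag_seq_range gr _ _.
- exact: flag_seq_range gr _ _.
Qed.

(** A flag and its flip are adjacent, hence they represent the two orbits. *)
Lemma chiral_orbits X Y j : flag_seq X -> flag_seq Y -> inside 0 n.+1 j ->
  orbit_eq X Y \/ orbit_eq (flip j X) Y.
Proof.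
move=> fX fY nj; have fX' := flip_flag P fX nj.
have [_ [A [B [_ _ _ AB]]] _] := C.
have no : ~ same_orbit (range X) (range (flip j X)).
  by move=> /(orbit_eq_range P fX fX'); apply: chiral_flip.
have {AB}AB Z : flag_seq Z -> same_orbit A (range Z) \/ same_orbit B (range Z).
  by move=> /(flag_seq_range gr)/AB.
have join D Z Z' : same_orbit D (range Z) -> same_orbit D (range Z') ->
    same_orbit (range Z) (range Z').
  by move=> /same_orbit_sym; apply: same_orbit_trans.
case: (AB X fX) (AB _ fX') (AB _ fY) => [x|x] [x'|x'] [y|y];
  by [case: no; apply: join x x'
     |left; apply: (orbit_eq_range P) => //; apply: join x y
     |right; apply: (orbit_eq_range P) => //; apply: join x' y].
Qed.

(** Stabilizers depend only on the orbit, so comparing them at [X] and at [flip j X] settles all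
    flags. *)
Lemma uniformly_regular_flip X j a b : flag_seq X -> inside 0 n.+1 j ->
  (b <= n.+1)%N ->
  (forall w, all (inside a b) w ->
     act X w = X <-> act (flip j X) w = flip j X) ->
  uniformly_regular n rk a b.
Proof.
move=> fX nj bn XX w hw Y Z fY fZ.
have hw0 := inside_sub (leq0n a) bn hw; have fX' := flip_flag P fX nj.
have iffX V : flag_seq V -> act X w = X <-> act V w = V.
  move=> fV; case: (chiral_orbits fX fV nj) => /(orbit_act P); first exact.
  by move=> /(_ w fX' hw0) <-; apply: XX.
by rewrite -iffX // -(iffX Z).
Qed.

(** The letters allowed are at distance at least 2 from [j], so their words commute with the flip at
    [j] and fix [X] exactly when they fix [flip j X]. *)
Lemma chiral_uniformly_regular a b j : (b <= n.+1)%N -> inside 0 n.+1 j ->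
  (forall i, inside a b i -> (i.+1 < j) || (j.+1 < i))%N ->
  uniformly_regular n rk a b.
Proof.
move=> bn nj hj; have [X fX] := flag_seq_exists gr.
apply: (uniformly_regular_flip fX nj bn) => w hw.
have hw0 := inside_sub (leq0n a) bn hw.
rewrite (act_flipC P) //; last exact: sub_all hw.
split=> [->//|/(congr1 (flip j))]; rewrite !(flipK P) //.
exact: act_flag.
Qed.

(** Regularity would yield an automorphism from [X] to [X' = flip 1 X]: a face reached from [X] by a
    word is sent to the face of the same height reached from [X'] by the same word. *)
Lemma chiral_not_uniformly_regular : (0 < n)%N ->
  ~ uniformly_regular n rk 0 n.+1.
Proof.
move=> n0 reg; have [X fX] := flag_seq_exists gr.
have n1 : inside 0 n.+1 1 by rewrite /inside; lia.
pose X' := flip 1 X; have fX' : flag_seq X' by apply: flip_flag.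
apply: (@chiral_flip X 1 fX n1).
have word x : exists w, all (inside 0 n.+1) w /\ act X w (h x) = x.
  have [Y [fY Yx _]] := flag_seq_through2 gr (lexx x).
  have [w hw eY] := flag_connected P (leqnn _) fX fY (flag_agree P fX fY).
  by exists w; rewrite -eY.
have [wd hwd] := choice word.
pose f x := act X' (wd x) (h x).
(* The value does not depend on the word: two flags through [x] differ by a word avoiding the letter
   [h x], and regularity carries this relation from [X] to [X']. *)
have fE w x : all (inside 0 n.+1) w -> act X w (h x) = x ->
    f x = act X' w (h x).
  move=> hw ew; have [hw' ew'] := hwd x.
  have fw := act_flag P fX hw; have fw' := act_flag P fX hw'.
  have [|v [hv xv ev]] := connected_avoiding P fw fw' (height_le_max gr x).
    by rewrite ew ew'.
  rewrite /f -(act_avoiding (act X' w) xv) -act_cat; congr (_ (h x)).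
  apply: (uniformly_regular_act P (leqnn _) reg hw' _ fX) => //.
    by rewrite all_cat hw.
  by rewrite act_cat.
have hf x : h (f x) = h x.
  have [hw _] := hwd x; rewrite (flag_seq_height (act_flag P fX' hw)) //.
  exact: height_le_max.
(* From [X], the word [1 :: wd x] leads to [f x]; from [X'], its first letter undoes the flip and
   the rest leads back to [x]. *)
have fK : cancel f f.
  move=> x; have [hw ew] := hwd x.
  rewrite (fE (1%N :: wd x)) ?hf //=; last by rewrite n1.
  by rewrite (flipK P).
have f_le x y : x <= y -> f x <= f y.
  move=> xy; have [Y [fY Yx Yy]] := flag_seq_through2 gr xy.
  have [w hw eY] := flag_connected P (leqnn _) fX fY (flag_agree P fX fY).
  rewrite !(fE w) -?eY //; exact: (flag_seq_le (act_flag P fX' hw) (height_le gr xy)).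
exists f.
  split; first by exists f.
  by move=> x y; apply/idP/idP => [/f_le|/f_le//]; rewrite !fK.
have fX_ i : (i <= n.+1)%N -> f (X i) = X' i.
  by move=> ni; rewrite (fE [::]) //= (flag_seq_height fX).
apply: funext => i /=; have [ni|ni] := leqP i n.+1; first exact: fX_.
have [_ Xt _] := fX; have [_ Xt' _] := fX'.
by rewrite -/X' Xt' ?(ltnW ni) // -(Xt' n.+1) // -fX_ // !Xt // ltnW.
Qed.

End ChiralRegularity.

(** * Sections as polytopes, and the extension of their flags *)

Section SectionPolytope.
Variables (n : nat) (d : Order.disp_t) (T : tbPOrderType d) (rk : T -> int).
Hypothesis P : polytope n rk.
Variables (m : nat) (F G : T) (leFG : F <= G).
Local Notation h := (height rk).
Local Notation rkS := (@section_rank d T rk F G leFG).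
Local Notation hS := (height rkS).
Hypothesis hFG : h G = (h F + m).+1.
Local Notation S := (section leFG).
Implicit Types (x y z : S) (Y : nat -> S).

Let gr := polytope_graded P.

Lemma section_height z : h (val z) = (h F + hS z)%N.
Proof.
have /andP[Fz _] := valP z.
have := height_le gr Fz; have := height_rank P (val z); have := height_rank P F.
rewrite /(height rkS) /section_rank; lia.
Qed.

Lemma section_graded : graded m hS.
Proof.
split.
- by apply: (@addnI (h F)); rewrite -section_height addn0.
- by apply: (@addnI (h F)); rewrite -section_height addnS -hFG.
- move=> x y; rewrite -lt_val => /(graded_lt gr).
  by rewrite !section_height ltn_add2l.
move=> x y; rewrite -lt_val => xy e.
suff : between (val x) (val y) = set0.
  by move=> /(graded_cover gr xy); rewrite !section_height; lia.
apply/seteqP; split=> // z /andP[xz zy].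
have /andP[Fx _] := valP x; have /andP[_ yG] := valP y.
have Fz : F <= z <= G by rewrite (le_trans Fx (ltW xz)) (le_trans (ltW zy) yG).
suff : between x y (Section leFG Fz) by rewrite e.
by apply/andP; rewrite -!lt_val.
Qed.

Lemma section_between x y : between (val x) (val y) = val @` between x y.
Proof.
apply/seteqP; split=> [z /andP[xz zy]|_ [z /andP[xz zy] <-]]; last first.
  by apply/andP; rewrite !lt_val.
have /andP[Fx _] := valP x; have /andP[_ yG] := valP y.
have Fz : F <= z <= G by rewrite (le_trans Fx (ltW xz)) (le_trans (ltW zy) yG).
by exists (Section leFG Fz) => //; apply/andP; rewrite -!lt_val.
Qed.

Lemma section_rank_lt x y : (rkS x < rkS y)%R = (rk (val x) < rk (val y))%R.
Proof. by rewrite /section_rank; lia. Qed.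

Lemma section_rank_le x y k :
  (rkS x + k <= rkS y)%R = (rk (val x) + k <= rk (val y))%R.
Proof. by rewrite /section_rank; lia. Qed.

Lemma section_rank_eq x y k :
  (rkS y = rkS x + k)%R <-> (rk (val y) = rk (val x) + k)%R.
Proof. by rewrite /section_rank; lia. Qed.

Lemma section_polytope : polytope m rkS.
Proof.
have hG := height_rank P G; have hF := height_rank P F.
split.
- by rewrite /section_rank /=; lia.
- by rewrite /section_rank /=; lia.
- move=> x y; rewrite -lt_val => /(polytope_rank_lt P).
  by rewrite section_rank_lt.
- move=> x y; rewrite -lt_val => xy e.
  apply/section_rank_eq/(polytope_rank_cover P xy).
  by rewrite section_between e image_set0.
- exact: flag_card section_graded.
- move=> x y; rewrite -lt_val => xy /section_rank_eq e.
  apply: card_eq_trans (polytope_diamond P xy e).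
  rewrite section_between card_eq_sym.
  by apply: inj_card_eq => u v _ _; apply: val_inj.
move=> x y; rewrite -lt_val => xy; rewrite section_rank_le => e u v xuy xvy.
have img z : between x y z -> between (val x) (val y) (val z).
  by rewrite section_between; exists z.
have [l [p [p0 pl pb ps]]] :=
  polytope_strongly_connected P xy e (img _ xuy) (img _ xvy).
have Fp i : (i <= l)%N -> F <= p i <= G.
  move=> /pb; rewrite section_between => -[z _ <-]; exact: (valP z).
(* The default [u] can only occur beyond index [l], where the path is not constrained. *)
pose q i : S := insubd u (p i).
have qE i : (i <= l)%N -> val (q i) = p i.
  by move=> il; rewrite /q val_insubd; rewrite Fp.
exists l, q; split.
- by apply: val_inj; rewrite qE.
- by apply: val_inj; rewrite qE.
- move=> i il; have := pb _ il; rewrite -(qE _ il) section_between.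
  by case=> z xzy /val_inj <-.
- by move=> i il; rewrite -!Order.le_val !qE ?ps // ltnW.
Qed.

Variable X : nat -> T.
Hypotheses (fX : flag_seq n h X) (XF : X (h F) = F) (XG : X (h G) = G).

(** The part of the base flag [X] between [F] and [G] is replaced by a flag of the section, whose
    indices are shifted by [h F]. *)
Definition extend_flag Y : nat -> T :=
  fun j => if (h F <= j <= h G)%N then val (Y (j - h F)%N) else X j.

Lemma extend_flag_at Y i : (i <= m.+1)%N ->
  extend_flag Y (h F + i) = val (Y i).
Proof.
by move=> im; rewrite /extend_flag hFG ifT ?addKn //; lia.
Qed.

Lemma extend_flag_seq Y : flag_seq m hS Y -> flag_seq n h (extend_flag Y).
Proof.
move=> fY; have hGn := height_le_max gr G; have [Xh Xt Xle] := fX.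
have Y0 : val (Y 0%N) = F by rewrite (flag_seq0 section_graded fY).
have Y1 : val (Y m.+1) = G by have [_ Yt _] := fY; rewrite Yt.
split.
- move=> i ni; rewrite /extend_flag; case: ifP => hi; last exact: Xh.
  by rewrite section_height (flag_seq_height fY); lia.
- move=> i ni; rewrite /extend_flag; case: ifP => hi; last exact: Xt.
  have e : i = h G by lia.
  have -> : (i - h F)%N = m.+1 by lia.
  by rewrite Y1 -XG Xt // -e.
move=> i; rewrite /extend_flag; case: ifP => hi; case: ifP => hi1.
- by rewrite Order.le_val; apply: flag_seq_le fY _; lia.
- have e : i = h G by lia.
  have -> : (i - h F)%N = m.+1 by lia.
  by rewrite Y1 -{1}XG e.
- have e : i.+1 = h F by lia.
  by apply: le_trans (Xle i) _; rewrite e subnn Y0 XF.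
exact: Xle.
Qed.

Lemma extend_flag_inj Y Z : flag_seq m hS Y -> flag_seq m hS Z ->
  extend_flag Y = extend_flag Z -> Y = Z.
Proof.
move=> fY fZ e; apply: funext => i; apply: val_inj.
have [im|mi] := leqP i m.+1; first by rewrite -!extend_flag_at // e.
by have [_ Yt _] := fY; have [_ Zt _] := fZ; rewrite Yt ?Zt // ltnW.
Qed.

Lemma extend_flag_flip Y i : flag_seq m hS Y -> inside 0 m.+1 i ->
  extend_flag (flip i Y) = flip (h F + i) (extend_flag Y).
Proof.
move=> fY mi; have fY' := flip_flag section_polytope fY mi.
have hGn := height_le_max gr G; have im : (0 < i < m.+1)%N by [].
apply: (flip_unique P) => //; try exact: extend_flag_seq.
- by rewrite /inside; lia.
- move=> j ji; rewrite /extend_flag; case: ifP => // hj.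
  by rewrite flip_off //; apply/eqP; lia.
rewrite !extend_flag_at; try lia.
by move/val_inj; have [] := flip_spec section_polytope fY mi.
Qed.

Lemma extend_flag_act Y w : flag_seq m hS Y -> all (inside 0 m.+1) w ->
  extend_flag (act Y w) = act (extend_flag Y) (map (addn (h F)) w).
Proof.
elim: w Y => //= i w IH Y fY /andP[mi mw].
by rewrite -extend_flag_flip // IH //; apply: (flip_flag section_polytope).
Qed.

(** An automorphism carrying one extension to the other fixes [F] and [G], so it restricts to the
    section. *)
Lemma extend_flag_orbit Y Z : flag_seq m hS Y -> flag_seq m hS Z ->
  orbit_eq (extend_flag Y) (extend_flag Z) -> orbit_eq Y Z.
Proof.
move=> fY fZ [f [[g fK gK] mf] e].
have fE i : (i <= m.+1)%N -> f (val (Y i)) = val (Z i).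
  by move=> im; rewrite -!extend_flag_at // -e.
have fF : f F = F.
  have := fE 0%N isT.
  by rewrite (flag_seq0 section_graded fY) (flag_seq0 section_graded fZ).
have fG : f G = G.
  by have := fE m.+1 (leqnn _); have [_ Yt _] := fY; have [_ Zt _] := fZ;
    rewrite Yt ?Zt.
have gF : g F = F by rewrite -{1}fF fK.
have gG : g G = G by rewrite -{1}fG fK.
have mg (x y : T) : (g x <= g y) = (x <= y) by rewrite -mf !gK.
have fS z : F <= f (val z) <= G.
  have /andP[Fz zG] := valP z; move: Fz zG.
  by rewrite -[_ <= val z]mf -[val z <= _]mf fF fG => -> ->.
have gS z : F <= g (val z) <= G.
  have /andP[Fz zG] := valP z; move: Fz zG.
  by rewrite -[_ <= val z]mg -[val z <= _]mg gF gG => -> ->.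
exists (fun z => Section leFG (fS z)).
  split; last by move=> x y; rewrite -!Order.le_val mf.
  by exists (fun z => Section leFG (gS z)) => z; apply: val_inj => /=.
apply: funext => i; apply: val_inj => /=.
have [im|mi] := leqP i m.+1; first exact: fE.
have [_ Yt _] := fY; have [_ Zt _] := fZ.
by rewrite Yt ?Zt ?(ltnW mi).
Qed.

End SectionPolytope.

(** If some flip of a section flag stayed in its orbit, the extensions of the two flags would have
    the same stabilizing words in the letters of the section. These extensions represent both orbits
    of the polytope, so the section would be uniformly regular. *)
Lemma chiral_section (n : nat) (d : Order.disp_t) (T : tbPOrderType d)
    (rk : T -> int) (m : nat) (F G : T) (leFG : F <= G) :
  chiral_polytope n rk -> height rk G = (height rk F + m).+1 -> (0 < m)%N ->
  ~ uniformly_regular n rk (height rk F) (height rk G) ->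
  chiral_polytope m (@section_rank d T rk F G leFG).
Proof.
move=> C hFG m0 nreg; have [P _ _] := C; have gr := polytope_graded P.
have PS := section_polytope P leFG hFG; have gS := section_graded P leFG hFG.
have [X [fX XF XG]] := flag_seq_through2 gr leFG.
have hGn := height_le_max gr G.
pose ext := @extend_flag d T rk F G leFG X.
have fext Y : flag_seq m (height (@section_rank d T rk F G leFG)) Y ->
    flag_seq n (height rk) (ext Y).
  exact: (extend_flag_seq P hFG fX XF XG).
have extf Y i : flag_seq m (height (@section_rank d T rk F G leFG)) Y ->
    inside 0 m.+1 i -> ext (flip i Y) = flip (height rk F + i) (ext Y).
  exact: (extend_flag_flip P hFG fX XF XG).
have exta Y w : flag_seq m (height (@section_rank d T rk F G leFG)) Y ->
    all (inside 0 m.+1) w ->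
    ext (act Y w) = act (ext Y) (map (addn (height rk F)) w).
  exact: (extend_flag_act P hFG fX XF XG).
have nflip Y i : flag_seq m (height (@section_rank d T rk F G leFG)) Y ->
    inside 0 m.+1 i -> ~ orbit_eq Y (flip i Y).
  move=> fY mi YY; apply: nreg; have fY' := flip_flag PS fY mi.
  have mi' : (0 < i < m.+1)%N by [].
  apply: (uniformly_regular_flip C (fext _ fY) (j := (height rk F + i)%N)) => //.
    by rewrite /inside; lia.
  move=> w hw; pose w' := map (fun j => j - height rk F)%N w.
  have hw' : all (inside 0 m.+1) w'.
    by rewrite all_map; apply: sub_all hw => j; rewrite /inside /=; lia.
  have ew : w = map (addn (height rk F)) w'.
    rewrite -map_comp map_id_in // => j /(allP hw); rewrite /inside /=; lia.
  rewrite -extf // ew -!exta //.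
  have inj := extend_flag_inj hFG; rewrite -/ext.
  have [a b] := orbit_act PS fY hw' YY.
  split=> /inj e; congr (extend_flag _ _); [apply: a|apply: b]; apply: e => //;
    exact: act_flag.
have nadj (D E : set (section leFG)) : flag D -> flag E ->
    adjacent D E -> ~ same_orbit D E.
  move=> /(flagP gS)[Y fY <-] /(flagP gS)[Z fZ <-].
  move=> /(adjacent_flipP PS fY fZ)[i mi eZ]; subst Z.
  by move=> /(orbit_eq_range PS fY fZ); apply: nflip.
split=> //.
have [Y fY] := flag_seq_exists gS; have m1 : inside 0 m.+1 1 by [].
have fY' := flip_flag PS fY m1.
exists (range Y), (range (flip 1 Y)); split.
- exact: (flag_seq_range gS).
- exact: (flag_seq_range gS).
- by move=> /(orbit_eq_range PS fY fY'); apply: nflip.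
(* There is no third orbit: the extension of [Z] lies in the orbit of that of [Y] or of its flip,
   and the automorphism restricts to the section. *)
move=> E /(flagP gS)[Z fZ <-].
have n1 : inside 0 n.+1 (height rk F + 1) by rewrite /inside; lia.
have := chiral_orbits C (fext _ fY) (fext _ fZ) n1.
rewrite -extf //; case=> /(extend_flag_orbit P hFG) o; [left|right];
  by apply: same_orbit_range; apply: o.
Qed.

(** * Counting flags: tight polytopes are flat *)

Section TightFlat.
Variables (n : nat) (d : Order.disp_t) (T : tbPOrderType d) (rk : T -> int).
Hypothesis P : polytope n rk.
Local Notation h := (height rk).
Implicit Types (x y z g : T) (s : seq T).

Let gr := polytope_graded P.

Let h_le_lt x y : x <= y -> (h x < h y)%N -> x < y.
Proof. exact: height_le_lt. Qed.

Let gt_trans : transitive (>%O : rel T).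
Proof. by move=> y x z yx zy; apply: lt_trans zy yx. Qed.

Definition covers x y : bool := (y < x) && (h x == (h y).+1).

(** The list omits [x] itself; the length [h x] forces it to go down to [\bot]. *)
Definition descending_flag x s : bool := path covers x s && (size s == h x).

Lemma descending_flag_lt x s : path covers x s -> path >%O x s.
Proof. by apply: sub_path => y z /andP[]. Qed.

Lemma descending_flag_set s : descending_flag \top s ->
  flag [set z | z \in \top :: s].
Proof.
move=> /andP[ps /eqP ss]; split.
  elim: s \top ps {ss} => [|y s IH] x /= ps u v.
    by rewrite /= !inE => /eqP-> /eqP->; left.
  have /allP lt : all (>%O x) (y :: s).
    by apply: (order_path_min gt_trans); apply: descending_flag_lt.
  have {ps}/IH{}IH : path covers y s by case/andP: ps.
  rewrite /= inE [v \in _]inE => /orP[/eqP->|us] /orP[/eqP->|vs].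
  - by left.
  - by right; apply/ltW/lt.
  - by left; apply/ltW/lt.
  - exact: IH.
move=> D cD sD; apply/seteqP; split=> // z Dz.
suff [y ys e] : exists2 y, y \in \top :: s & h y = h z.
  by rewrite (chain_height_inj gr cD Dz (sD _ ys)).
move: (height_le_max gr z); rewrite -(graded_top gr).
elim: s (\top : T) ps ss {sD} => [|y s IH] x ps ss; rewrite leq_eqVlt => /orP[/eqP e|].
- by exists x; rewrite ?mem_head.
- by rewrite -ss.
- by exists x; rewrite ?mem_head.
case/andP: ps => /andP[_ /eqP hx] ps; rewrite hx ltnS => /IH[//||u us e].
  by move: ss; rewrite hx => -[].
by exists u; rewrite // inE us orbT.
Qed.

Lemma descending_flag_inj s s' : descending_flag \top s ->
  descending_flag \top s' ->
  [set z | z \in \top :: s] = [set z | z \in \top :: s'] -> s = s'.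
Proof.
move=> /andP[/descending_flag_lt ps _] /andP[/descending_flag_lt ps' _] e.
have : \top :: s = \top :: s'.
  have irr : irreflexive (>%O : rel T) by move=> z; apply: ltxx.
  apply: (@irr_sorted_eq _ _ gt_trans irr (\top :: s) (\top :: s') ps ps') => z.
  apply/idP/idP => zs; first by have : [set z | z \in \top :: s'] z by rewrite -e.
  by have : [set z | z \in \top :: s] z by rewrite e.
by case.
Qed.

(** A lower bound on the number of flags below [x], witnessed by an explicit list so that no
    finiteness of [T] is needed. *)
Definition has_descending_flags x (M : nat) : Prop :=
  exists ss : seq (seq T),
    [/\ uniq ss, all (descending_flag x) ss & size ss = M].

Lemma has_descending_flags_le x M M' : (M' <= M)%N ->
  has_descending_flags x M -> has_descending_flags x M'.
Proof.
move=> le [ss [us fs sM]]; exists (take M' ss); split.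
- exact: take_uniq.
- by apply/allP => s /mem_take /(allP fs).
- by rewrite size_takel // sM.
Qed.

Lemma has_descending_flags_card (M N : nat) :
  flag (T:=T) #= `I_N -> has_descending_flags \top M -> (M <= N)%N.
Proof.
move=> fN [ss [us fs sM]]; rewrite -card_le_II -(card_le_eqr fN).
pose F s : set T := [set z | z \in \top :: s].
have ssP i : (i < M)%N -> descending_flag \top (nth [::] ss i).
  by move=> iM; apply/(all_nthP _ fs); rewrite sM.
have e : (fun i => F (nth [::] ss i)) @` `I_M #= `I_M.
  apply: inj_card_eq => i j; rewrite !inE /= => iM jM.
  move=> /(descending_flag_inj (ssP _ iM) (ssP _ jM)) /eqP.
  by rewrite nth_uniq ?sM // => /eqP.
rewrite -(card_le_eql e); apply: subset_card_le => _ [i iM <-].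
exact/descending_flag_set/ssP.
Qed.

Lemma has_descending_flags_sum x (es : seq T) (M : T -> nat) : uniq es ->
  all (covers x) es -> (forall y, y \in es -> has_descending_flags y (M y)) ->
  has_descending_flags x (\sum_(y <- es) M y).
Proof.
move=> ues ces Mes.
(* The strengthened statement also records the first faces of the lists, which keeps the families
   attached to distinct [y] disjoint. *)
suff [ss [us fs _ sM]] : exists ss : seq (seq T), [/\ uniq ss,
    all (descending_flag x) ss, all (fun s => head x s \in es) ss
    & size ss = \sum_(y <- es) M y] by exists ss.
elim: es ues ces Mes => [|y es IH] /=; first by exists [::]; rewrite big_nil.
move=> /andP[yes ues] /andP[cy ces] Mes.
have [|ss [us fs hs sM]] := IH ues ces.
  by move=> z zs; apply: Mes; rewrite inE zs orbT.
have [sy [uy fy My]] := Mes y (mem_head _ _).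
exists (map (cons y) sy ++ ss); split.
- rewrite cat_uniq us map_inj_uniq ?uy => [|? ? []//]; rewrite andbT /=.
  apply/hasPn => s /(allP hs) + ; apply: contraTN => /mapP[s' _ ->] /=.
  exact: yes.
- rewrite all_cat fs andbT all_map; apply: sub_all fy => s /andP[ps /eqP ss'].
  rewrite /descending_flag /= cy ps /= ss'.
  by case/andP: cy => _ /eqP ->.
- rewrite all_cat all_map; apply/andP; split.
    by apply/allP => s _ /=; rewrite mem_head.
  by apply: sub_all hs => s; rewrite inE => ->; rewrite orbT.
by rewrite size_cat size_map sM My big_cons.
Qed.

Variable p : 'I_n.-1 -> nat.
Hypothesis eqv : equivelar rk p.

Definition type_entry (i : nat) : nat := if insub i is Some j then p j else 0.

(** The number of flags of a tight polytope of rank [k.+1], hence the bound expected below a face of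
    height [k.+2]. *)
Definition min_flags (k : nat) : nat := 2 * \prod_(i < k) type_entry i.

Lemma min_flagsS k : min_flags k.+1 = (min_flags k * type_entry k)%N.
Proof. by rewrite /min_flags big_ord_recr mulnA. Qed.

Lemma polygon_edges g x k : (k < n.-1)%N -> g <= x -> h g = k -> h x = k.+3 ->
  (1 < type_entry k)%N /\ exists es : seq T, [/\ uniq es,
    all (covers x) es, all (fun y => g < y) es & size es = type_entry k].
Proof.
move=> kn gx hg hx; rewrite /type_entry insubT.
set i : 'I_n.-1 := Sub k kn.
have hi : nat_of_ord i = k by [].
have [||p1 [f [bf fle]]] := @eqv i g x gx.
- by have := height_rank P g; rewrite hi; lia.
- by have := height_rank P x; rewrite hi; lia.
split=> //.
have fh a b : polygon_le a b && ~~ polygon_le b a ->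
    (h (val (f a)) < h (val (f b)))%N.
  rewrite -!fle => ab; apply: (graded_lt gr).
  by rewrite lt_val lt_leAnge.
(* Three strict steps lead from the bottom to the top of the polygon, within heights [k] to [k.+3];
   this forces every edge to have height [k.+2]. *)
have edge j : [/\ covers x (val (f (PolygonEdge j)))
    & g < val (f (PolygonEdge j))].
  have h1 : (h (val (f (PolygonBot _))) < h (val (f (PolygonVertex j))))%N.
    exact: fh.
  have h2 : (h (val (f (PolygonVertex j))) < h (val (f (PolygonEdge j))))%N.
    by apply: fh; rewrite /= eqxx.
  have h3 : (h (val (f (PolygonEdge j))) < h (val (f (PolygonTop _))))%N.
    exact: fh.
  have /andP[g0 _] := valP (f (PolygonBot _)).
  have /andP[_ x0] := valP (f (PolygonTop _)).
  have /andP[ge ex] := valP (f (PolygonEdge j)).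
  have {}g0 := height_le gr g0; have {}x0 := height_le gr x0.
  split; last by apply: h_le_lt ge _; lia.
  apply/andP; split; first by apply: h_le_lt ex _; lia.
  by apply/eqP; lia.
exists [seq val (f (PolygonEdge j)) | j <- enum 'I_(p i)]; split.
- rewrite map_inj_uniq ?enum_uniq // => a b /val_inj/(bij_inj bf).
  by case.
- by apply/allP => _ /mapP[j _ ->]; case: (edge j).
- by apply/allP => _ /mapP[j _ ->]; case: (edge j).
- by rewrite size_map size_enum_ord.
Qed.

Lemma has_descending_flags_const x (es : seq T) M : uniq es ->
  all (covers x) es -> (forall y, y \in es -> has_descending_flags y M) ->
  has_descending_flags x (size es * M).
Proof.
move=> ues ces Mes; have := has_descending_flags_sum ues ces Mes.
by rewrite big_const_seq count_predT iter_addn_0 mulnC.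
Qed.

(* Fix a face [g] three ranks below [x]: the polygon [x / g] already provides
   the required number of faces covered by [x], so that an extra face of that
   kind, or an extra flag below one of them, gives an extra flag. *)
Lemma many_descending_flags k x : (k <= n.-1)%N -> h x = k.+2 ->
  [/\ (0 < min_flags k)%N, has_descending_flags x (min_flags k)
    & (exists u w, [/\ u <= x, w <= x, (h u + 2 <= h w)%N & ~~ (u <= w)]) ->
      has_descending_flags x (min_flags k).+1].
Proof.
elim: k x => [|k IH] x kn hx.
  rewrite /min_flags big_ord0 muln1; split=> //; last first.
    (* At height 2 the gap forces [u] to be [\bot], so no non-incident pair exists. *)
    move=> [u [w [ux wx huw]]]; have := height_le gr wx => hwx.
    by rewrite (height_eq0 gr (x := u)) ?le0x //; lia.
  have [|z /andP[bz zx] hz] := @interpolate _ _ _ _ gr \bot x 1 (le0x x).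
    by rewrite (graded_bot gr) hx.
  have bzx : \bot < z < x.
    by rewrite !h_le_lt ?(graded_bot gr) ?hz ?hx.
  have [|z' [/andP[bz' zx'] nz'] _] := diamond P _ bzx.
    by rewrite (graded_bot gr).
  have hz' : h z' = 1%N.
    have := graded_lt gr bz'; have := graded_lt gr zx'.
    by rewrite hx (graded_bot gr); lia.
  have := @has_descending_flags_const x [:: z; z'] 1.
  apply.
  - by rewrite /= inE andbT; apply/eqP => /esym.
  - by rewrite /= /covers zx' hx hz hz' h_le_lt ?hz ?hx.
  move=> y ys; have hy : h y = 1%N.
    by move: ys; rewrite !inE => /orP[/eqP->|/eqP->].
  exists [:: [:: \bot]]; split=> //; rewrite /= /descending_flag /covers /=.
  by rewrite hy (graded_bot gr) h_le_lt ?le0x ?hy ?(graded_bot gr).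
have kn' : (k <= n.-1)%N by apply: ltnW.
have IHy y : covers x y -> h y = k.+2.
  by move=> /andP[_ /eqP]; rewrite hx; case.
have poly g (gx : g <= x) (hg : h g = k) := polygon_edges kn gx hg hx.
have [|g0 /andP[_ g0x] hg0] := @interpolate _ _ _ _ gr \bot x k (le0x x).
  by rewrite (graded_bot gr) hx; lia.
have [pk [es0 [u0 c0 _ s0]]] := poly g0 g0x hg0.
have c0' y : y \in es0 -> has_descending_flags y (min_flags k).
  by move=> /(allP c0)/IHy/(IH _ kn')[].
have N0 : (0 < min_flags k)%N.
  case: es0 s0 c0 {u0 c0'} => [|y es]; first by rewrite /=; lia.
  by move=> _ /= /andP[/IHy/(IH _ kn')[]].
split.
- by rewrite min_flagsS muln_gt0 N0; lia.
- by rewrite min_flagsS mulnC -s0; apply: has_descending_flags_const.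
move=> [u [w [ux wx huw uw]]].
have hw : (h w < h x)%N.
  rewrite ltn_neqAle (height_le gr wx) andbT; apply: contraNN uw => /eqP e.
  by rewrite (height_inj_le gr wx e).
have [|y /andP[wy yx] hy] := @interpolate _ _ _ _ gr w x k.+2 wx; first by lia.
have cy : covers x y.
  by apply/andP; split; [apply: (h_le_lt yx); lia|apply/eqP; lia].
have [uy|nuy] := boolP (u <= y).
  (* The pair lies below [y], which has an extra flag by induction. As [y] may or may not belong to
     [es0], it is put in front and removed from the rest, which loses at most one face. *)
  pose M z := if z == y then (min_flags k).+1 else min_flags k.
  have uy0 : uniq (y :: rem y es0).
    by rewrite /= rem_uniq // mem_rem_uniq // !inE eqxx.
  have rem_neq z : z \in rem y es0 -> z != y.
    by rewrite mem_rem_uniq // => /andP[].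
  have cy0 : all (covers x) (y :: rem y es0).
    by rewrite /= cy; apply/allP => z /mem_rem/(allP c0).
  have eM : (\sum_(z <- y :: rem y es0) M z =
      (min_flags k).+1 + min_flags k * size (rem y es0))%N.
    rewrite big_cons {1}/M eqxx; congr addn.
    rewrite big_seq (eq_bigr (fun=> min_flags k)).
      by rewrite -big_seq big_const_seq count_predT iter_addn_0.
    by move=> z /rem_neq /negPf; rewrite /M => ->.
  have H : has_descending_flags x
      ((min_flags k).+1 + min_flags k * size (rem y es0)).
    rewrite -eM; apply: has_descending_flags_sum => // z zy.
    rewrite /M; have [ez|nz] := eqVneq z y; last first.
      by have /IHy/(IH _ kn')[] := allP cy0 _ zy.
    subst z; have [_ _] := IH y kn' hy; apply.
    by exists u, w.
  apply: has_descending_flags_le H; rewrite min_flagsS addSn ltnS -mulnS leq_mul2l.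
  apply/orP; right; rewrite -s0.
  have [yes|nyes] := boolP (y \in es0); first by rewrite size_rem ?leqSpred.
  by rewrite rem_id.
(* Here [u] is not below [y]. With [g] chosen above [u], every edge of the polygon [x / g] lies
   above [u], so [y] is an additional face covered by [x]. *)
have [|g /andP[ug gx] hg] := @interpolate _ _ _ _ gr u x k ux.
  by rewrite hx; lia.
have [_ [es [ues ces ges ses]]] := poly g gx hg.
have yes : y \notin es.
  apply: contra nuy => /(allP ges) gy; exact: le_trans ug (ltW gy).
have uy : uniq (y :: es) by rewrite /= yes.
have cyes : all (covers x) (y :: es) by rewrite /= cy.
have := @has_descending_flags_const x _ (min_flags k) uy cyes.
move=> H; have {}H : has_descending_flags x (size (y :: es) * min_flags k).
  by apply: H => z zy; have /IHy/(IH _ kn')[] := allP cyes _ zy.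
apply: has_descending_flags_le H.
have -> : size (y :: es) = (type_entry k).+1 by rewrite /= ses.
by rewrite min_flagsS mulnC mulSn -[(_ * _).+1]add1n leq_add2r.
Qed.

Lemma tight_flat : (0 < n)%N -> flag (T:=T) #= `I_(2 * \prod_(i < n.-1) p i) ->
  forall x y, (h x + 2 <= h y)%N -> x <= y.
Proof.
move=> n0 fN x y hxy; apply: contraT => nxy.
have htop : h \top = (n.-1).+2 by rewrite (graded_top gr) prednK.
have [_ _ H] := many_descending_flags (leqnn _) htop.
have {}H : has_descending_flags \top (min_flags n.-1).+1.
  by apply: H; exists x, y; rewrite !lex1.
have := has_descending_flags_card fN H.
rewrite /min_flags (eq_bigr p) ?ltnn // => i _.
by rewrite /type_entry valK.
Qed.

End TightFlat.

(** * Chirality of sections in ranks 4 and 5 *)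

Lemma chiral_section_of_rank (n : nat) (d : Order.disp_t) (T : tbPOrderType d)
    (rk : T -> int) (a b : nat) (F G : T) (leFG : F <= G) :
  chiral_polytope n rk -> rk F = (a%:Z - 1)%R -> rk G = (b%:Z - 1)%R ->
  (a.+1 < b)%N -> ~ uniformly_regular n rk a b ->
  chiral_polytope (b - a).-1 (@section_rank d T rk F G leFG).
Proof.
move=> C rF rG ab; have [P _ _] := C.
have hF : height rk F = a by have := height_rank P F; lia.
have hG : height rk G = b by have := height_rank P G; lia.
rewrite -{1}hF -{1}hG => nreg.
by apply: (chiral_section leFG C _ _ nreg); rewrite ?hF ?hG; lia.
Qed.

Lemma tight_chiral_not_regular (n : nat) (d : Order.disp_t) (T : tbPOrderType d)
    (rk : T -> int) (a b : nat) :
  chiral_polytope n rk -> tight n rk -> (a + 5 <= b <= n.+1)%N ->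
  ~ uniformly_regular n rk a b ->
  ~ uniformly_regular n rk a b.-1 \/ ~ uniformly_regular n rk a.+1 b.
Proof.
move=> [P _ _] [p [eqv fN]] ab nreg; apply/not_andP => -[reg1 reg2]; apply: nreg.
apply: (uniformly_regular_extend P ab _ reg1 reg2).
by apply: (tight_flat P eqv _ fN); lia.
Qed.

Theorem theorem3p5 (d : Order.disp_t) (T : tbPOrderType d) (rk : T -> int) :
  (chiral_polytope 4 rk -> tight 4 rk ->
     chiral_facets 4 rk \/ chiral_vertex_figures 4 rk) /\
  (chiral_polytope 5 rk -> tight 5 rk ->
     [/\ chiral_facets 5 rk, chiral_vertex_figures 5 rk
       & chiral_medial_sections 5 rk]).
Proof.
split=> C t; have [P _ _] := C.
  have nreg := chiral_not_uniformly_regular C isT.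
  case: (tight_chiral_not_regular C t _ nreg) => // {}nreg;
    [left=> F rF|right=> v rv].
    by apply: (chiral_section_of_rank (a := 0) (b := 4) _ C);
      rewrite ?(polytope_rank_bot P).
  by apply: (chiral_section_of_rank (a := 1) (b := 5) _ C);
    rewrite ?(polytope_rank_top P).
(* The two kinds of corank 2 sections: below a face of rank 3 the letters commute with the flip of
   the facet, and above a face of rank 1 with the flip of the vertex. *)
have reg04 : uniformly_regular 5 rk 0 4.
  by apply: (chiral_uniformly_regular C (j := 5)) => // i; rewrite /inside; lia.
have reg26 : uniformly_regular 5 rk 2 6.
  by apply: (chiral_uniformly_regular C (j := 1)) => // i; rewrite /inside; lia.
have nreg15 : ~ uniformly_regular 5 rk 1 5.
  (* The whole polytope is not regular, so the facets or the vertex-figures are not. Splitting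
     either once more leaves the medial sections, because [reg04] and [reg26] exclude the
     alternatives. *)
  case: (tight_chiral_not_regular C t _ (chiral_not_uniformly_regular C isT)) => //.
    by case/(@tight_chiral_not_regular _ _ _ _ 0 5 C t isT).
  by case/(@tight_chiral_not_regular _ _ _ _ 1 6 C t isT).
(* Regular facets or vertex-figures would have regular medial sections. *)
have sub a b : (a <= 1)%N -> (5 <= b)%N -> ~ uniformly_regular 5 rk a b.
  by move=> a1 b5 /(uniformly_regular_sub a1 b5).
split=> [F rF|v rv|v F levF rv rF].
- by apply: (chiral_section_of_rank (a := 0) (b := 5) _ C);
    rewrite ?(polytope_rank_bot P) //; apply: sub.
- by apply: (chiral_section_of_rank (a := 1) (b := 6) _ C);
    rewrite ?(polytope_rank_top P) //; apply: sub.
- by apply: (chiral_section_of_rank (a := 1) (b := 5) _ C).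
Qed.
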